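(* In the setting and with the notation of the context, for any $Y\in\mathfrak g$ we have $$\mathcal L^*\pi(Y)u^*=\pi([Y,X])u^*.$$ Consequently, $\mathcal L^*$ can be restricted to a bounded operator on the center space $\mathcal V=\{\pi(Y)u^*:Y\in\mathfrak g\}$.
   Context: $\mathcal X$ is a real Banach space, $\mathcal L(\mathcal X)$ the bounded linear operators on it. $A$ is a closed (possibly unbounded) linear operator on $\mathcal X$ with domain $\mathcal D(A)$, and $F:\mathcal X\to\mathcal X$ is a map. The equation is $\mathrm du=Au\,\mathrm dt+F(u)\,\mathrm dt$. Standing assumptions: (1) Symmetry. $\mathbb G$ is a matrix Lie group with Lie algebra $\mathfrak g$ (bracket $[\cdot,\cdot]$, exponential map $\exp(Y)=e^Y$, a fixed norm $\|\cdot\|_{\mathfrak g}$), and $\Pi:\mathbb G\to\mathcal L(\mathcal X)$ is a group homomorphism such that: for $g\in\mathbb G$ and $\phi\in\mathcal D(A)$ we have $\Pi(g)\phi\in\mathcal D(A)$, $A\phi=\Pi(g)A\Pi(g^{-1})\phi$ and $F(\phi)=\Pi(g)F(\Pi(g^{-1})\phi)$; for each $\phi\in\mathcal X$ the map $g\mapsto\Pi(g)\phi$ is continuous; $\sup_{g}\|\Pi(g)\|_{\mathcal L(\mathcal X)}<\infty$. For $Y\in\mathfrak g$, $\pi(Y)$ is the unbounded operator $\pi(Y)\phi=\lim_{t\to0}t^{-1}(\Pi(e^{tY})\phi-\phi)$ (limit in $\mathcal X$), whose domain $\mathcal D(\pi(Y))$ consists of all $\phi\in\mathcal X$ for which the limit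 exists. (2) Symmetry solution. There are $X\in\mathfrak g$ and $u^*\in\mathcal D(A)\cap\mathcal D(\pi(X))$ such that $\hat u(t)=\Pi(e^{tX})u^*$, $t\ge0$, is a strong solution of the equation. Moreover $u^*\in\mathcal D(\pi(Y))$ for all $Y\in\mathfrak g$ and there is a constant $C$ with $\|\Pi(e^Y)u^*-u^*-\pi(Y)u^*\|_{\mathcal X}\le C\|Y\|_{\mathfrak g}^2$ for all $Y\in\mathfrak g$. (3) Linearization. $F$ is Fréchet differentiable at $u^*$, and the operator $\mathcal L^*:\phi\mapsto A\phi-\pi(X)\phi+F'(u^* )\phi$ (natural domain $\mathcal D(A)\cap\mathcal D(\pi(X))$; $^*$ does not denote an adjoint) generates a bounded $C_0$-semigroup $(S^*(t))_{t\ge0}$ on $\mathcal X$. *)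

(* Defs.v *)
From HB Require Import structures.
From mathcomp Require Import all_boot all_order all_algebra.
From mathcomp Require Import all_classical all_reals all_analysis.
From mathcomp Require Import complex.

Set Implicit Arguments.
Unset Strict Implicit.
Unset Printing Implicit Defensive.

Import Order.TTheory GRing.Theory Num.Theory.
Import numFieldNormedType.Exports.

Local Open Scope classical_set_scope.
Local Open Scope ring_scope.

Definition expmx (K : numFieldType) (n : nat) (Y : 'M[K]_n) : 'M[K]_n :=
  lim (series (fun k : nat => k`!%:R^-1 *: Y ^+ k) @ \oo).

Definition lie_bracket (K : numFieldType) (n : nat) (Y Z : 'M[K]_n) : 'M[K]_n :=
  Y *m Z - Z *m Y.

Definition matrix_group (K : numFieldType) (n : nat) (G : set 'M[K]_n) : Prop :=
  [/\ forall g, G g -> g \in unitmx,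
      G 1%:M,
      forall g h, G g -> G h -> G (g *m h) &
      forall g, G g -> G (invmx g)].

(* Closedness is relative to the general linear group. *)
Definition matrix_lie_group (K : numFieldType) (n : nat) (G : set 'M[K]_n) :
    Prop :=
  matrix_group G /\
  exists Z : set 'M[K]_n, closed Z /\ G = Z `&` [set g | g \in unitmx].

(* Real matrix Lie groups are covered: a closed subgroup of GL_n(R) is also a
   closed subgroup of GL_n(C), with the same Lie algebra.  The Lie algebra is a
   vector space over R only, even though its elements are complex matrices. *)
Definition lie_algebra (R : realType) (n : nat) (G : set 'M[R[i]]_n) :
    set 'M[R[i]]_n :=
  [set Y | forall t : R, G (expmx ((t%:C)%C *: Y))].

Definition norm_on (R : realType) (n : nat) (g : set 'M[R[i]]_n)
    (nrm : 'M[R[i]]_n -> R) : Prop :=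
  [/\ forall Y, g Y -> nrm Y = 0 -> Y = 0,
      forall (a : R) Y, g Y -> nrm ((a%:C)%C *: Y) = `|a| * nrm Y &
      forall Y Z, g Y -> g Z -> nrm (Y + Z) <= nrm Y + nrm Z].

(* Values of [op] outside [dom] are irrelevant. *)
Record partial_op (T : Type) := PartialOp { dom : set T ; op :> T -> T }.

Definition linear_op (R : realType) (V : normedModType R) (B : partial_op V) :
    Prop :=
  dom B 0 /\
  forall (a : R) x y, dom B x -> dom B y ->
    dom B (a *: x + y) /\ B (a *: x + y) = a *: B x + B y.

Definition closed_op (R : realType) (V : normedModType R) (B : partial_op V) :
    Prop :=
  closed [set p : V * V | dom B p.1 /\ p.2 = B p.1].

Definition bounded_representation (R : realType) (V : normedModType R)
    (K : numFieldType) (n : nat) (G : set 'M[K]_n)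
    (Pi : 'M[K]_n -> {linear V -> V}) : Prop :=
  [/\ forall g, G g -> continuous (Pi g),
      forall phi, Pi 1%:M phi = phi,
      forall g h phi, G g -> G h -> Pi (g *m h) phi = Pi g (Pi h phi),
      forall phi, {within G, continuous (fun g => Pi g phi)} &
      exists M : R, forall g phi, G g -> `|Pi g phi| <= M * `|phi| ].

Definition pi_op (R : realType) (V : normedModType R) (n : nat)
    (Pi : 'M[R[i]]_n -> {linear V -> V}) (Y : 'M[R[i]]_n) : partial_op V :=
  let q (phi : V) (t : R) :=
    t^-1 *: (Pi (expmx ((t%:C)%C *: Y)) phi - phi) in
  PartialOp [set phi | cvg (q phi @ 0^')] (fun phi => lim (q phi @ 0^')).

Definition abs_continuous (R : realType) (V : normedModType R) (T : R)
    (u : R -> V) : Prop :=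
  forall e : R, 0 < e -> exists2 d : R, 0 < d &
    forall (m : nat) (a b : nat -> R),
      (forall k, (k < m)%N -> 0 <= a k /\ a k <= b k /\ b k <= T) ->
      (forall k, (k.+1 < m)%N -> b k <= a k.+1) ->
      \sum_(k < m) (b k - a k) < d ->
      \sum_(k < m) `|u (b k) - u (a k)| < e.

(* Equivalent to u(t) = u(0) + \int_0^t (A u(s) + F(u(s))) ds for all t >= 0
   with a Bochner integral: a locally absolutely continuous function that is
   differentiable almost everywhere is the integral of its derivative. *)
Definition strong_solution (R : realType) (V : normedModType R)
    (A : partial_op V) (F : V -> V) (u : R -> V) : Prop :=
  (forall T : R, 0 < T -> abs_continuous T u) /\
  {ae lebesgue_measure, forall t : R, 0 < t ->
     dom A (u t) /\ is_derive t 1 u (A (u t) + F (u t))}.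

Definition bounded_C0_semigroup (R : realType) (V : normedModType R)
    (S : R -> {linear V -> V}) : Prop :=
  [/\ forall t, 0 <= t -> continuous (S t),
      forall phi, S 0 phi = phi,
      forall s t phi, 0 <= s -> 0 <= t -> S (s + t) phi = S s (S t phi),
      forall phi, S t phi @[t --> 0^'+] --> phi &
      exists M : R, forall t phi, 0 <= t -> `|S t phi| <= M * `|phi| ].

Definition generates (R : realType) (V : normedModType R) (B : partial_op V)
    (S : R -> {linear V -> V}) : Prop :=
  forall phi psi : V,
    (dom B phi /\ B phi = psi) <->
    (t^-1 *: (S t phi - phi) @[t --> 0^'+] --> psi).

Definition linearization (R : realType) (V : normedModType R) (n : nat)
    (A : partial_op V) (F : V -> V) (Pi : 'M[R[i]]_n -> {linear V -> V})
    (X : 'M[R[i]]_n) (u : V) : partial_op V :=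
  PartialOp (dom A `&` dom (pi_op Pi X))
            (fun phi => A phi - pi_op Pi X phi + 'd F u phi).

Definition center_space (R : realType) (V : normedModType R) (n : nat)
    (G : set 'M[R[i]]_n) (Pi : 'M[R[i]]_n -> {linear V -> V}) (u : V) : set V :=
  [set pi_op Pi Y u | Y in lie_algebra G].

Definition restricts_to_bounded (R : realType) (V : normedModType R)
    (B : partial_op V) (W : set V) : Prop :=
  [/\ W `<=` dom B,
      forall v, W v -> W (B v),
      linear_op (PartialOp W B) &
      exists M : R, forall v, W v -> `|B v| <= M * `|v| ].

(* Main.v *)
Require Import Defs.
From HB Require Import structures.
From mathcomp Require Import all_boot all_order all_algebra.
From mathcomp Require Import all_classical all_reals all_analysis.
From mathcomp Require Import complex.
From mathcomp Require Import ring lra.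

Set Implicit Arguments.
Unset Strict Implicit.
Unset Printing Implicit Defensive.

Import Order.TTheory GRing.Theory Num.Theory.
Import numFieldNormedType.Exports.

Local Open Scope classical_set_scope.
Local Open Scope ring_scope.

(** Write T(Y) for pi(Y)u and L for the linearization.  Along the group orbit
    of u everything is explicit.  Evaluating the equation at one time gives
    pi(X)u = Au + F(u) ([solution_generator]); by equivariance, for g in G the
    point Pi(g)u lies in the domain of L and
      L Pi(g)u = Pi(g) T(X - g^-1 X g) - F(Pi(g)u) + F'(u) Pi(g)u
    ([linearization_orbit]).  Take g = exp(tY) and form the difference quotient
    at t = 0.  The points (Pi(g)u - u)/t tend to T(Y).  Their images under L
    tend to T([Y, X]): the remainder of F is o(t) by differentiability, and
    (X - g^-1 X g)/t tends to [Y, X] ([adjoint_derivative]).  As a semigroup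
    generator L is closed, hence T(Y) is in its domain and L T(Y) = T([Y, X])
    ([linearization_center]).  It is essential to apply closedness to L and not
    to A or pi(X) separately: nothing says that pi(X)u lies in the domain of
    pi(Y), so the two limits need not exist one by one.

    The argument uses that T is linear and continuous on the Lie algebra, and
    that the Lie algebra is closed under sums and limits.  Both sum statements
    come from the Lie product formula
      exp(Y + Z) = lim (exp(Y/k) exp(Z/k))^k   ([lie_product]).
    For the group it is the usual argument.  For T, the k-th power moves u by
    k small steps, each equal to (T(Y) + T(Z))/k up to a small error, and
    boundedness and strong continuity of Pi keep the accumulated error small
    ([iter_drift], [tangent_orbitD]).  The same bookkeeping, applied to the
    powers of S(t/k), shows that a generator is closed without any integral in
    the Banach space ([generator_closed]).

    Continuity of T, closedness of the Lie algebra, and boundedness of L on the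
    center space are finite-dimensional facts, obtained in real coordinates: a
    real subspace of matrices is the image of a projection matrix
    ([subspace_projection]), a linear map from row vectors is bounded, and a
    linear map vanishing on the kernel of another is dominated by it, by
    compactness of a unit sphere ([row_linear_factor_bound]). *)

(** * A real norm on complex matrices *)

Section sum_norm.
Variables (R : realType).
Import ComplexField.Normc.

Lemma normc_ge0 (z : R[i]) : 0 <= normc z.
Proof. by case: z => a b; exact: sqrtr_ge0. Qed.

Lemma norm_normc (z : R[i]) : `|z| = (normc z)%:C%C.
Proof. by []. Qed.

Lemma normc_real (a : R) : normc (a%:C)%C = `|a|.
Proof. by rewrite /normc /= expr0n /= addr0 sqrtr_sqr. Qed.

Lemma le_Re_normc (z : R[i]) : `|complex.Re z| <= normc z.
Proof. by have := normc_ge_Re z; rewrite norm_normc lecR. Qed.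

Lemma le_Im_normc (z : R[i]) : `|complex.Im z| <= normc z.
Proof.
case: z => a b /=; rewrite -[leLHS]ger0_norm// -sqrtr_sqr ler_wsqrtr//.
by rewrite real_normK ?num_real// lerDr sqr_ge0.
Qed.

Lemma normc_le_ReIm (z : R[i]) : normc z <= `|complex.Re z| + `|complex.Im z|.
Proof.
case: z => a b /=.
rewrite -[leRHS]ger0_norm ?addr_ge0// -sqrtr_sqr ler_wsqrtr//.
rewrite sqrrD !real_normK ?num_real// [leRHS]addrAC lerDl.
by rewrite mulrn_wge0// mulr_ge0.
Qed.

(** Real-valued, so that it can be compared with real exponentials and with
    norms of the Banach space. *)
Definition sumnorm m n (A : 'M[R[i]]_(m, n)) : R :=
  \sum_i \sum_j normc (A i j).

Local Notation N := sumnorm.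

Lemma sumnorm_ge0 m n (A : 'M[R[i]]_(m, n)) : 0 <= N A.
Proof. by apply: sumr_ge0 => i _; apply: sumr_ge0 => j _; exact: normc_ge0. Qed.

Lemma sumnorm0 m n : N (0 : 'M[R[i]]_(m, n)) = 0.
Proof. by rewrite /N big1// => i _; rewrite big1// => j _; rewrite mxE normc0. Qed.

Lemma le_normc_sumnorm m n (A : 'M[R[i]]_(m, n)) i j : normc (A i j) <= N A.
Proof.
rewrite /N (bigD1 i)//= (bigD1 j)//= -addrA lerDl addr_ge0//.
  by apply: sumr_ge0 => k _; exact: normc_ge0.
by apply: sumr_ge0 => k _; apply: sumr_ge0 => l _; exact: normc_ge0.
Qed.

Lemma sumnormD m n (A B : 'M[R[i]]_(m, n)) : N (A + B) <= N A + N B.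
Proof.
rewrite /N -big_split ler_sum// => i _; rewrite -big_split ler_sum// => j _.
by rewrite mxE le_normcD.
Qed.

Lemma sumnormN m n (A : 'M[R[i]]_(m, n)) : N (- A) = N A.
Proof.
by apply: eq_bigr => i _; apply: eq_bigr => j _; rewrite mxE normcN.
Qed.

Lemma sumnorm_distC m n (A B : 'M[R[i]]_(m, n)) : N (A - B) = N (B - A).
Proof. by rewrite -sumnormN opprB. Qed.

Lemma sumnormB m n (A B : 'M[R[i]]_(m, n)) : N (A - B) <= N A + N B.
Proof. by rewrite (le_trans (sumnormD _ _))// sumnormN. Qed.

Lemma sumnormZ m n (a : R) (A : 'M[R[i]]_(m, n)) : N (a%:C%C *: A) = `|a| * N A.
Proof.
rewrite /N mulr_sumr; apply: eq_bigr => i _; rewrite mulr_sumr.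
by apply: eq_bigr => j _; rewrite mxE normcM normc_real.
Qed.

Lemma sumnorm_sum m n (I : Type) (s : seq I) (P : pred I)
    (f : I -> 'M[R[i]]_(m, n)) :
  N (\sum_(i <- s | P i) f i) <= \sum_(i <- s | P i) N (f i).
Proof.
elim/big_rec2: _ => [|i x y _ le]; first by rewrite sumnorm0.
by rewrite (le_trans (sumnormD _ _))// lerD2l.
Qed.

Lemma normc_sum (I : Type) (s : seq I) (P : pred I) (f : I -> R[i]) :
  normc (\sum_(i <- s | P i) f i) <= \sum_(i <- s | P i) normc (f i).
Proof.
elim/big_rec2: _ => [|i x y _ le]; first by rewrite normc0.
by rewrite (le_trans (le_normcD _ _))// lerD2l.
Qed.

Lemma sumnormM m n p (A : 'M[R[i]]_(m, n)) (B : 'M[R[i]]_(n, p)) :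
  N (A *m B) <= N A * N B.
Proof.
rewrite /N mulr_suml ler_sum// => i _.
rewrite (@le_trans _ _ (\sum_j \sum_k normc (A i k) * normc (B k j)))//.
  apply: ler_sum => j _; rewrite mxE (le_trans (normc_sum _ _ _))//.
  by rewrite ler_sum// => k _; rewrite normcM.
rewrite exchange_big /= mulr_suml ler_sum// => k _; rewrite -mulr_sumr.
rewrite ler_wpM2l ?normc_ge0// (bigD1 k)//= lerDl.
by apply: sumr_ge0 => l _; apply: sumr_ge0 => j _; exact: normc_ge0.
Qed.

Lemma sumnorm_eq0 m n (A : 'M[R[i]]_(m, n)) : N A <= 0 -> A = 0.
Proof.
move=> A0; apply/matrixP => i j; rewrite mxE; apply: eq0_normc; apply/eqP.
by rewrite eq_le normc_ge0 andbT (le_trans (le_normc_sumnorm _ _ _) A0).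
Qed.

(** Balls of the sum norm are cofinal among the entrywise balls that define
    the topology; every topological hypothesis on matrices is used in this
    form. *)
Lemma nbhs_sumnormP m n (A : 'M[(R[i] : numFieldType)]_(m, n))
    (U : set 'M[(R[i] : numFieldType)]_(m, n)) :
  nbhs A U <-> exists2 e : R, 0 < e & forall B, N (B - A) < e -> U B.
Proof.
split=> [/nbhs_ballP[e e0 AU]|[e e0 AU]].
  have eR : e = (complex.Re e)%:C%C by rewrite RRe_real// gtr0_real.
  have e0' : 0 < complex.Re e by move: e0; rewrite /= ltcE => /andP[].
  exists (complex.Re e) => // B BA; apply: AU; rewrite eR.
  split=> [|i j]; first by rewrite ltcE /= eqxx.
  rewrite /ball /= norm_normc ltcR (le_lt_trans _ BA)//.
  by rewrite sumnorm_distC; have := le_normc_sumnorm (A - B) i j; rewrite !mxE.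
apply/nbhs_ballP.
pose k : R := (m * n)%:R + 1.
have k0 : 0 < k by rewrite ltr_wpDl.
exists (e / k)%:C%C; first by rewrite /= ltcE /= eqxx divr_gt0.
move=> B [_ AB]; apply: AU.
rewrite (@le_lt_trans _ _ (\sum_(i < m) \sum_(j < n) e / k))//.
  apply: ler_sum => i _; apply: ler_sum => j _.
  by have := AB i j; rewrite /ball/= norm_normc ltcR !mxE -normcN opprB => /ltW.
rewrite !sumr_const !card_ord -mulrnA mulnC -mulr_natl mulrA.
by rewrite ltr_pdivrMr// mulrC ltr_pM2l// /k ltrDl.
Qed.

End sum_norm.

(** * The matrix exponential *)

Section exponential.
Variables (R : realType).
Import ComplexField.Normc.
Local Notation N := (@sumnorm R _ _).

(** Completeness: the real and imaginary parts of every entry form absolutely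
    convergent real series. *)
Lemma sumnorm_summable m n (u : nat -> 'M[R[i]]_(m, n)) (b : nat -> R) :
  (forall k, N (u k) <= b k) -> cvgn (series b) ->
  exists E, N (\sum_(0 <= j < k) u j - E) @[k --> \oo] --> (0 : R).
Proof.
move=> ub cb.
have reim (h : R[i] -> R) : {morph h : x y / x + y} -> h 0 = 0 ->
    (forall z, `|h z| <= normc z) ->
    forall i j, cvgn (series (fun k => h (u k i j))).
  move=> hD h0 hle i j; apply: normed_cvg.
  apply: (series_le_cvg _ _ _ cb) => [k|k|k] //=.
    by rewrite (le_trans _ (ub k))// sumnorm_ge0.
  by rewrite (le_trans (hle _))// (le_trans (le_normc_sumnorm _ _ _)).
have ReD : {morph @complex.Re R : x y / x + y} by move=> [? ?] [? ?].
have ImD : {morph @complex.Im R : x y / x + y} by move=> [? ?] [? ?].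
have Re0 : complex.Re 0 = 0 :> R by [].
have Im0 : complex.Im 0 = 0 :> R by [].
have cRe := reim _ ReD Re0 (@le_Re_normc R).
have cIm := reim _ ImD Im0 (@le_Im_normc R).
pose E : 'M[R[i]]_(m, n) := \matrix_(i, j)
  (Complex (limn (series (fun k => complex.Re (u k i j))))
           (limn (series (fun k => complex.Im (u k i j))))).
exists E.
pose B k := \sum_i \sum_j
  (`|series (fun k => complex.Re (u k i j)) k - complex.Re (E i j)| +
   `|series (fun k => complex.Im (u k i j)) k - complex.Im (E i j)|).
have B0 : B k @[k --> \oo] --> (0 : R).
  have -> : (0 : R) = \sum_(i < m) \sum_(j < n) (`|0 : R| + `|0 : R|).
    by rewrite big1// => i _; rewrite big1// => j _; rewrite normr0 addr0.
  apply: cvg_big => [|i _]; first exact: add_continuous.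
  apply: cvg_big => [|j _]; first exact: add_continuous.
  rewrite !mxE /=; apply: cvgD; apply: cvg_norm.
    rewrite -(subrr (limn (series (fun k => complex.Re (u k i j))))).
    by apply: cvgB; [exact: cRe|exact: cvg_cst].
  rewrite -(subrr (limn (series (fun k => complex.Im (u k i j))))).
  by apply: cvgB; [exact: cIm|exact: cvg_cst].
apply: (squeeze_cvgr _ (cvg_cst 0) B0).
near=> k; rewrite sumnorm_ge0/= /B ler_sum// => i _; rewrite ler_sum// => j _.
rewrite (le_trans (normc_le_ReIm _))// !mxE summxE /series /=.
rewrite -(big_morph _ ReD Re0) -(big_morph _ ImD Im0).
by case: (\sum_(0 <= _ < _) _) => a c.
Unshelve. all: by end_near.
Qed.

Variable n : nat.
Implicit Types A B : 'M[R[i]]_n.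

Definition expmx_term A j : 'M[R[i]]_n := (j`!%:R^-1 : R)%:C%C *: A ^+ j.

(** The factor [n.+1] only serves the exponent 0, where the sum norm of the
    identity is [n]. *)
Lemma sumnormX A j : N (A ^+ j) <= n.+1%:R * N A ^+ j.
Proof.
elim: j => [|j IH].
  rewrite !expr0 mulr1 /sumnorm.
  rewrite (@le_trans _ _ (\sum_(i < n) 1))//; last first.
    by rewrite sumr_const card_ord ler_nat.
  apply: ler_sum => i _; rewrite (bigD1 i)//= big1; last first.
    by move=> k ki; rewrite mxE eq_sym (negPf ki) normc0.
  by rewrite mxE eqxx normc1 addr0.
rewrite !exprSr (le_trans (sumnormM _ _))// mulrA.
by rewrite ler_wpM2r// sumnorm_ge0.
Qed.

Lemma sumnormXS A j : N (A ^+ j.+1) <= N A ^+ j.+1.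
Proof.
elim: j => [//|j IH]; rewrite exprSr [leRHS]exprSr.
by rewrite (le_trans (sumnormM _ _))// ler_wpM2r// sumnorm_ge0.
Qed.

Lemma sumnorm_exp_term A j :
  N (expmx_term A j) <= n.+1%:R * exp_coeff (N A) j.
Proof.
rewrite /expmx_term sumnormZ ger0_norm ?invr_ge0// /exp_coeff /= mulrA [leRHS]mulrC.
by rewrite ler_wpM2l ?invr_ge0// sumnormX.
Qed.

Lemma expmx_cvg A :
  N (\sum_(0 <= j < k) expmx_term A j - expmx A) @[k --> \oo] --> (0 : R).
Proof.
have [|E AE] := @sumnorm_summable _ _ (expmx_term A) _ (sumnorm_exp_term A).
  have := is_cvg_seriesZ (k := n.+1%:R : R) (@is_cvg_series_exp_coeff R (N A)).
  exact.
suff -> : expmx A = E by [].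
apply: cvg_lim; first exact: norm_hausdorff.
move=> U /nbhs_sumnormP[e e0 EU].
move/cvgrPdist_lt : AE => /(_ _ e0) [k0 _ AE]; exists k0 => // k kk0.
apply: EU; have := AE k kk0; rewrite sub0r normrN ger0_norm ?sumnorm_ge0//.
congr (N (_ - _) < e); rewrite /series /=; apply: eq_bigr => j _.
by congr (_ *: _); rewrite fmorphV rmorph_nat.
Qed.

End exponential.

Section exponential_laws.
Variables (R : realType).
Local Notation N := (@sumnorm R _ _).

(** Summing by antidiagonals. The square partial sums of a Cauchy product
    exceed this triangle by the terms with [k <= i + j]. *)
Lemma sum_triangle (W : nmodType) (f : nat -> nat -> W) k :
  \sum_(m < k) \sum_(j < m.+1) f (m - j)%N j =
  \sum_(i < k) \sum_(j < k | (i + j < k)%N) f i j.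
Proof.
under eq_bigr => m _.
  rewrite (big_ord_widen k (fun j => f (m - j)%N j) (ltn_ord m)); over.
rewrite (exchange_big_dep xpredT)//= [RHS](exchange_big_dep xpredT)//=.
apply: eq_bigr => j _.
rewrite -(big_mkord (fun m => j < m.+1)%N (fun m => f (m - j)%N j)).
have jk : (j <= k)%N by exact: ltnW.
rewrite (big_cat_nat _ jk)//=.
rewrite big_nat_cond big1 ?add0r; last first.
  by move=> i /andP[/andP[_ ij]]; rewrite ltnS leqNgt ij.
rewrite -{1}(add0n (j : nat)) big_addn.
rewrite big_mkord.
rewrite (big_ord_widen_cond k (fun i => j < (i + j).+1)%N
  (fun i => f (i + j - j)%N j) (leq_subr _ _)).
apply: eq_big => [i|i _]; last by rewrite addnK.
by rewrite ltnS leq_addl /= ltn_subRL addnC.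
Qed.

(** For a convolution [c], the product of two partial sums is a partial sum of
    [c] plus the terms above the antidiagonal. The same identity for matrices
    and for reals makes the real exponential control the matrix one. *)
Lemma mul_sum_triangle (T : pzRingType) (a b c : nat -> T) k :
  (forall m, c m = \sum_(j < m.+1) a (m - j)%N * b j) ->
  (\sum_(0 <= i < k) a i) * (\sum_(0 <= j < k) b j) =
  \sum_(0 <= m < k) c m +
  \sum_(i < k) \sum_(j < k | ~~ (i + j < k)%N) a i * b j.
Proof.
move=> abc; rewrite !big_mkord mulr_suml.
rewrite (eq_bigr _ (fun (m : 'I_k) _ => abc m)).
rewrite (sum_triangle (fun i j => a i * b j)) -big_split /=.
by apply: eq_bigr => i _; rewrite mulr_sumr (bigID (fun j : 'I_k => i + j < k)%N).
Qed.

Lemma binomial_inv_fact m j : (j <= m)%N ->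
  m`!%:R^-1 * 'C(m, j)%:R = (m - j)`!%:R^-1 * j`!%:R^-1 :> R.
Proof.
move=> jm; rewrite -(bin_fact jm) !natrM.
have fN0 i : i`!%:R != 0 :> R by rewrite pnatr_eq0 -lt0n fact_gt0.
have CN0 : 'C(m, j)%:R != 0 :> R by rewrite pnatr_eq0 -lt0n bin_gt0.
by field; rewrite !fN0 CN0.
Qed.

Lemma exp_coeff_convol (a b : R) m : exp_coeff (a + b) m =
  \sum_(j < m.+1) exp_coeff a (m - j)%N * exp_coeff b j.
Proof.
rewrite /exp_coeff /= exprDn mulr_suml; apply: eq_bigr => j _.
transitivity (a ^+ (m - j) * b ^+ j * (m`!%:R^-1 * 'C(m, j)%:R)).
  by rewrite -mulr_natr; ring.
by rewrite binomial_inv_fact -1?ltnS//; ring.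
Qed.

Variable n : nat.
Implicit Types A B : 'M[R[i]]_n.

Lemma expmx_term_convol A B m : GRing.comm A B -> expmx_term (A + B) m =
  \sum_(j < m.+1) expmx_term A (m - j)%N * expmx_term B j.
Proof.
move=> AB; rewrite /expmx_term exprDn_comm// scaler_sumr.
apply: eq_bigr => j _; rewrite -[X in _ *: X]scaler_nat scalerA.
have -> : ('C(m, j)%:R : R[i]) = ('C(m, j)%:R : R)%:C%C by rewrite rmorph_nat.
rewrite -rmorphM /= binomial_inv_fact -1?ltnS//.
by rewrite -[RHS]scalemxAl -scalemxAr scalerA -rmorphM.
Qed.

Lemma exp_coeff_sum_cvg (a : R) :
  \sum_(0 <= j < k) exp_coeff a j @[k --> \oo] --> expR a.
Proof. exact: is_cvg_series_exp_coeff. Qed.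

Lemma exp_coeff_sum_le (a : R) k : 0 <= a ->
  \sum_(0 <= j < k) exp_coeff a j <= expR a.
Proof.
move=> a0; apply: (nondecreasing_cvgn_le _ (is_cvg_series_exp_coeff a)).
by apply: nondecreasing_series => j _ _; exact: exp_coeff_ge0.
Qed.

Definition mxcvg (u : nat -> 'M[R[i]]_n) E :=
  N (u k - E) @[k --> \oo] --> (0 : R).

Lemma mxcvg_squeeze u E (b : nat -> R) :
  (forall k, N (u k - E) <= b k) -> b k @[k --> \oo] --> (0 : R) -> mxcvg u E.
Proof.
move=> ub b0; apply: (squeeze_cvgr _ (cvg_cst 0) b0).
by apply: nearW => k; rewrite ub sumnorm_ge0.
Qed.

Lemma mxcvgP u E : mxcvg u E <->
  forall e : R, 0 < e -> \forall k \near \oo, N (u k - E) < e.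
Proof.
split=> [/cvgrPdist_lt uE e e0|uE].
  by apply: filterS (uE e e0) => k; rewrite sub0r normrN ger0_norm ?sumnorm_ge0.
apply/cvgrPdist_lt => e e0; apply: filterS (uE e e0) => k.
by rewrite sub0r normrN ger0_norm ?sumnorm_ge0.
Qed.

Lemma mxcvg_le u E F (c : R) :
  mxcvg u E -> (\forall k \near \oo, N (u k - F) <= c) -> N (E - F) <= c.
Proof.
move=> /mxcvgP uE uc; apply/ler_addgt0Pl => e e0.
near \oo => k.
rewrite -(subrKA (u k)) (le_trans (sumnormD _ _))// lerD//.
  by rewrite sumnorm_distC ltW//; near: k; exact: uE.
by near: k; exact: uc.
Unshelve. all: by end_near.
Qed.

Lemma mxcvg_unique u E F : mxcvg u E -> mxcvg u F -> E = F.
Proof.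
move=> uE /mxcvgP uF; apply/eqP; rewrite -subr_eq0; apply/eqP.
apply: sumnorm_eq0; apply/ler_addgt0Pl => e e0; rewrite addr0.
by apply: mxcvg_le uE _; apply: filterS (uF e e0) => k /ltW.
Qed.

Lemma mxcvgM u v E F :
  mxcvg u E -> mxcvg v F -> mxcvg (fun k => u k * v k) (E * F).
Proof.
move=> uE vF; apply: (@mxcvg_squeeze _ _ (fun k =>
  N (u k - E) * N (v k - F) + N (u k - E) * N F + N E * N (v k - F))).
  move=> k; have -> : u k * v k - E * F =
      (u k - E) * (v k - F) + (u k - E) * F + E * (v k - F).
    by rewrite -mulrDr subrK mulrBl mulrBr addrA subrK.
  rewrite (le_trans (sumnormD _ _))// lerD ?sumnormM//.
  by rewrite (le_trans (sumnormD _ _))// lerD ?sumnormM.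
rewrite -[0](_ : 0 * 0 + 0 * N F + N E * 0 = 0); last by ring.
apply: cvgD; first apply: cvgD; apply: cvgM => //; exact: cvg_cst.
Qed.

Lemma mxcvg_exp A : mxcvg (fun k => \sum_(0 <= j < k) expmx_term A j) (expmx A).
Proof. exact: expmx_cvg. Qed.

Lemma expmx_eq u A : mxcvg (fun k => \sum_(0 <= j < k) expmx_term A j) u ->
  expmx A = u.
Proof. exact/mxcvg_unique/mxcvg_exp. Qed.

Opaque expmx.

(** The defect of the partial sums consists of products above the
    antidiagonal. Its norm is at most a constant times the same defect for the
    real series of the norms, which tends to 0 because the real exponential is
    multiplicative. *)
Lemma expmxD A B : GRing.comm A B -> expmx (A + B) = expmx A * expmx B.
Proof.
move=> AB; apply: (mxcvg_unique _ (mxcvgM (mxcvg_exp A) (mxcvg_exp B))).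
pose S a k := \sum_(0 <= j < k) exp_coeff (a : R) j.
pose K := n.+1%:R * n.+1%:R : R.
have D0 : K * (S (N A) k * S (N B) k - S (N A + N B) k) @[k --> \oo] --> (0:R).
  rewrite -[0](_ : K * (expR (N A) * expR (N B) - expR (N A + N B)) = 0).
    apply: cvgM; first exact: cvg_cst.
    apply: cvgB; last exact: exp_coeff_sum_cvg.
    by apply: cvgM; exact: exp_coeff_sum_cvg.
  by rewrite expRD subrr mulr0.
have E0 : mxcvg (fun k => (\sum_(0 <= i < k) expmx_term A i) *
    (\sum_(0 <= j < k) expmx_term B j) -
    \sum_(0 <= m < k) expmx_term (A + B) m) 0.
  apply: mxcvg_squeeze D0 => k; rewrite subr0.
  rewrite (mul_sum_triangle _ (fun m => expmx_term_convol m AB)).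
  rewrite /S (mul_sum_triangle _ (exp_coeff_convol (N A) (N B))).
  rewrite !(addrC (\sum_(0 <= _ < _) _)) !addrK mulr_sumr.
  rewrite (le_trans (sumnorm_sum _ _ _))// ler_sum// => i _.
  rewrite mulr_sumr (le_trans (sumnorm_sum _ _ _))// ler_sum// => j _.
  rewrite (le_trans (sumnormM _ _))// /K mulrACA.
  by rewrite ler_pM ?sumnorm_ge0// sumnorm_exp_term.
apply: (@mxcvg_squeeze _ _ (fun k => 
  N (\sum_(0 <= i < k) expmx_term (A + B) i - expmx (A + B)) +
  N ((\sum_(0 <= i < k) expmx_term A i) *
    (\sum_(0 <= j < k) expmx_term B j) -
    \sum_(0 <= m < k) expmx_term (A + B) m - 0))).
  move=> k; rewrite subr0 [leRHS]addrC (le_trans _ (sumnormD _ _))//.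
  by rewrite subrKA.
have := cvgD (mxcvg_exp (A + B)) E0.
by rewrite addr0; apply.
Qed.

(** Only positive exponents occur in the tail, where the sum norm of a power
    is at most the power of the norm. *)
Lemma expmx_tail A m : (0 < m)%N ->
  N (expmx A - \sum_(0 <= j < m) expmx_term A j) <=
  expR (N A) - \sum_(0 <= j < m) exp_coeff (N A) j.
Proof.
move=> m0; apply: mxcvg_le (mxcvg_exp A) _; exists m => // k /= mk.
rewrite lerBrDl (le_trans _ (exp_coeff_sum_le k (sumnorm_ge0 A)))//.
rewrite [\sum_(0 <= _ < k) expmx_term _ _](big_cat_nat _ mk)//=.
rewrite [\sum_(0 <= _ < k) exp_coeff _ _](big_cat_nat _ mk)//=.
rewrite (addrC (\sum_(0 <= _ < m) expmx_term _ _)) addrK.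
rewrite lerD2l (le_trans (sumnorm_sum _ _ _))// !big_nat ler_sum// => j.
case: j => [|j]; first by rewrite leqn0 => /andP[/eqP m00]; rewrite m00 in m0.
move=> _; rewrite sumnormZ ger0_norm ?invr_ge0// /exp_coeff /= [leRHS]mulrC.
by rewrite ler_wpM2l ?invr_ge0// sumnormXS.
Qed.

Lemma expmx_near1 A : N (expmx A - 1) <= expR (N A) - 1.
Proof.
have := @expmx_tail A 1 isT.
by rewrite !big_nat1 /expmx_term /exp_coeff /= !expr0 fact0 invr1 scale1r mulr1.
Qed.

Lemma expmx_taylor2 A : N (expmx A - 1 - A) <= N A ^+ 2 * expR (N A).
Proof.
have := @expmx_tail A 2 isT.
rewrite !big_nat_recl//= !big_geq// /expmx_term /exp_coeff /= !expr0 !expr1.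
rewrite fact0 (factS 0) fact0 !invr1 !scale1r !mulr1 !addr0 !opprD !addrA.
move=> /le_trans; apply.
set a := N A.
have a0 : 0 <= a by exact: sumnorm_ge0.
have e0 := expR_gt0 a.
have := expR_ge1Dx (- a); rewrite expRN => h.
have h2 : (1 - a) * expR a <= 1 by rewrite -ler_pdivlMr// mul1r.
nra.
Qed.

Lemma expmx0 : expmx (0 : 'M[R[i]]_n) = 1.
Proof.
apply/eqP; rewrite -subr_eq0; apply/eqP/sumnorm_eq0.
by rewrite (le_trans (expmx_near1 _))// sumnorm0 expR0 subrr.
Qed.

Lemma expmxN A : expmx A *m expmx (- A) = 1%:M.
Proof.
rewrite mulmxE -expmxD ?subrr ?expmx0//.
by rewrite /GRing.comm mulrN mulNr.
Qed.

Lemma expmx_unit A : expmx A \in unitmx.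
Proof. exact: (mulmx1_unit (expmxN A)).1. Qed.

Lemma expmx_inv A : invmx (expmx A) = expmx (- A).
Proof.
by rewrite -[RHS]mul1mx -(mulVmx (expmx_unit A)) -mulmxA expmxN mulmx1.
Qed.

Lemma expmx_conj A P : P \in unitmx ->
  expmx (invmx P *m A *m P) = invmx P *m expmx A *m P.
Proof.
move=> uP; apply: expmx_eq.
have conjX j : (invmx P *m A *m P) ^+ j = invmx P *m (A ^+ j) *m P.
  elim: j => [|j IH]; first by rewrite !expr0 mulmx1 mulVmx.
  by rewrite exprSr IH exprSr -!mulmxE !mulmxA mulmxK.
apply: (@mxcvg_squeeze _ _ (fun k => N (invmx P) *
  N (\sum_(0 <= j < k) expmx_term A j - expmx A) * N P)).
  move=> k; rewrite (_ : _ - _ = invmx P *m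
    (\sum_(0 <= j < k) expmx_term A j - expmx A) *m P).
    rewrite (le_trans (sumnormM _ _))// ler_wpM2r ?sumnorm_ge0//.
    by rewrite (le_trans (sumnormM _ _)).
  rewrite mulmxBr mulmxBl; congr (_ - _).
  rewrite mulmx_sumr mulmx_suml; apply: eq_bigr => j _.
  by rewrite /expmx_term conjX -scalemxAr -scalemxAl.
rewrite -[(0 : R)](_ : N (invmx P) * (0 : R) * N P = 0);
  last by rewrite mulr0 mul0r.
by apply: cvgM; [apply: cvgM; [exact: cvg_cst|exact: mxcvg_exp]|exact: cvg_cst].
Qed.

End exponential_laws.

(** * The Lie product formula and the adjoint action *)

Section lie_product.
Variables (R : realType) (n : nat).
Implicit Types A B Y Z : 'M[R[i]]_n.
Local Notation N := (@sumnorm R _ _).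

(** A multiplicative measure of the distance to the identity: the exponents
    add up under products, so powers of a matrix are controlled without
    constants. *)
Definition near_one (a : R) A := N (A - 1) <= expR a - 1.

Lemma near_oneM a b A B :
  near_one a A -> near_one b B -> near_one (a + b) (A * B).
Proof.
rewrite /near_one => hA hB.
have -> : A * B - 1 = (A - 1) * (B - 1) + (A - 1) + (B - 1).
  by rewrite mulrBr mulr1 subrK mulrBl mul1r addrA subrK.
have A0 := sumnorm_ge0 (A - 1); have B0 := sumnorm_ge0 (B - 1).
have h1 := sumnormD ((A - 1) * (B - 1) + (A - 1)) (B - 1).
have h2 := sumnormD ((A - 1) * (B - 1)) (A - 1).
have h3 := sumnormM (A - 1) (B - 1).
rewrite expRD; have := ler_pM A0 B0 hA hB.
nra.
Qed.

Lemma near_one_mull a A B : near_one a A -> N (A * B) <= expR a * N B.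
Proof.
rewrite /near_one => hA; have -> : A * B = (A - 1) * B + B.
  by rewrite mulrBl mul1r subrK.
have h1 := sumnormD ((A - 1) * B) B; have h2 := sumnormM (A - 1) B.
have := ler_wpM2r (sumnorm_ge0 B) hA; nra.
Qed.

Lemma near_one_mulr a A B : near_one a A -> N (B * A) <= expR a * N B.
Proof.
rewrite /near_one => hA; have -> : B * A = B * (A - 1) + B.
  by rewrite mulrBr mulr1 subrK.
have h1 := sumnormD (B * (A - 1)) B; have h2 := sumnormM B (A - 1).
have := ler_wpM2r (sumnorm_ge0 B) hA; nra.
Qed.

Lemma near_oneX a A k : near_one a A -> near_one (a *+ k) (A ^+ k).
Proof.
move=> hA; elim: k => [|k IH].
  by rewrite /near_one mulr0n expr0 subrr sumnorm0 expR0 subrr.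
by rewrite mulrS exprS; exact: near_oneM.
Qed.

(** Telescoping: the difference of two [k]-th powers is a sum of [k] terms
    containing one factor [A - B] and powers of [A] and [B]. *)
Lemma sumnorm_subX a A B k : 0 <= a -> near_one a A -> near_one a B ->
  N (A ^+ k - B ^+ k) <= k%:R * expR (a *+ k) * N (A - B).
Proof.
move=> a0 hA hB; elim: k => [|k IH].
  by rewrite !expr0 subrr sumnorm0 !mul0r.
have -> : A ^+ k.+1 - B ^+ k.+1 = A * (A ^+ k - B ^+ k) + (A - B) * B ^+ k.
  by rewrite !exprS mulrBr mulrBl addrA subrK.
have h1 := sumnormD (A * (A ^+ k - B ^+ k)) ((A - B) * B ^+ k).
have h2 := near_one_mull (A ^+ k - B ^+ k) hA.
have h3 := near_one_mulr (A - B) (near_oneX k hB).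
rewrite (mulrS a) expRD -nat1r.
have e1 : 1 <= expR a by rewrite -expR0 ler_expR.
have h4 := ler_wpM2l (expR_ge0 a) IH.
have h5 : 0 <= (expR a - 1) * (expR (a *+ k) * N (A - B)).
  by rewrite mulr_ge0 ?subr_ge0// mulr_ge0 ?expR_ge0 ?sumnorm_ge0.
lra.
Qed.

(** Both matrices agree with [1 + Y + Z] up to second order. *)
Lemma expmx_mul_taylor2 Y Z :
  N (expmx Y * expmx Z - expmx (Y + Z)) <=
  2 * (N Y + N Z) ^+ 2 * expR (N Y + N Z).
Proof.
set y := N Y; set z := N Z; set s := y + z.
have y0 : 0 <= y := sumnorm_ge0 Y. have z0 : 0 <= z := sumnorm_ge0 Z.
pose b := expmx (Y + Z) - 1 - (Y + Z).
have -> : expmx Y * expmx Z - expmx (Y + Z) =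
  (expmx Y - 1) * (expmx Z - 1) + (expmx Y - 1 - Y) + (expmx Z - 1 - Z) - b.
  rewrite mulrBr mulr1 mulrBl mul1r /b; move: (expmx Y * expmx Z) => P.
  have ringE (T : comPzRingType) (p e a c y1 z1 o : T) : p - e =
      p - c - (a - o) + (a - o - y1) + (c - o - z1) - (e - o - (y1 + z1)).
    by ring.
  by apply/matrixP => i j; rewrite !mxE; exact: ringE.
have hb : N b <= s ^+ 2 * expR s.
  rewrite (le_trans (expmx_taylor2 _))// ler_pM ?expR_ge0 ?sqr_ge0//.
    by rewrite ler_sqr ?nnegrE ?sumnorm_ge0 ?addr_ge0// sumnormD.
  by rewrite ler_expR sumnormD.
have hY := expmx_taylor2 Y; have hZ := expmx_taylor2 Z.
have exp1 x : expR x - 1 <= x * expR x.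
  have := expR_ge1Dx (- x); rewrite expRN => h.
  have : (1 - x) * expR x <= 1 by rewrite -ler_pdivlMr ?expR_gt0// mul1r.
  nra.
have hYZ : N ((expmx Y - 1) * (expmx Z - 1)) <= (y * expR y) * (z * expR z).
  rewrite (le_trans (sumnormM _ _))// ler_pM ?sumnorm_ge0//.
    by rewrite (le_trans (expmx_near1 Y))// exp1.
  by rewrite (le_trans (expmx_near1 Z))// exp1.
rewrite (le_trans (sumnormB _ _))//.
have h1 := sumnormD ((expmx Y - 1) * (expmx Z - 1) + (expmx Y - 1 - Y))
  (expmx Z - 1 - Z).
have h2 := sumnormD ((expmx Y - 1) * (expmx Z - 1)) (expmx Y - 1 - Y).
rewrite -/y -/z in hY hZ.
have ey : 1 <= expR y by rewrite -expR0 ler_expR.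
have ez : 1 <= expR z by rewrite -expR0 ler_expR.
have h3 : y ^+ 2 * expR y <= y ^+ 2 * expR s.
  by rewrite ler_wpM2l ?sqr_ge0// ler_expR lerDl.
have h4 : z ^+ 2 * expR z <= z ^+ 2 * expR s.
  by rewrite ler_wpM2l ?sqr_ge0// ler_expR lerDr.
have h5 : (y * expR y) * (z * expR z) = y * z * expR s by rewrite expRD; ring.
have h6 : 0 <= y * z * expR s by rewrite !mulr_ge0 ?expR_ge0.
rewrite h5 in hYZ.
have -> : 2 * s ^+ 2 * expR s = s ^+ 2 * expR s +
    (y ^+ 2 * expR s + z ^+ 2 * expR s + 2 * (y * z * expR s)) by rewrite /s; ring.
lra.
Qed.

Lemma expmxX A k : expmx (A *+ k) = expmx A ^+ k.
Proof.
elim: k => [|k IH]; first by rewrite mulr0n expr0 expmx0.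
rewrite mulrS exprS expmxD ?IH//; exact/commrMn.
Qed.

Definition lie_step Y Z k : 'M[R[i]]_n :=
  expmx ((k.+1%:R^-1 : R)%:C%C *: Y) * expmx ((k.+1%:R^-1 : R)%:C%C *: Z).

Lemma lie_step_near_one Y Z k :
  near_one ((N Y + N Z) / k.+1%:R) (lie_step Y Z k).
Proof.
rewrite mulrDl; have k0 : 0 <= (k.+1%:R^-1 : R) by rewrite invr_ge0.
apply: near_oneM; rewrite /near_one.
  by rewrite (le_trans (expmx_near1 _))// sumnormZ ger0_norm// mulrC.
by rewrite (le_trans (expmx_near1 _))// sumnormZ ger0_norm// mulrC.
Qed.

(** Over [k] steps the second-order error of one step, of size [1 / k^2],
    accumulates to [1 / k]. *)
Lemma lie_product Y Z :
  mxcvg (fun k => lie_step Y Z k ^+ k.+1) (expmx (Y + Z)).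
Proof.
pose s := N Y + N Z.
have s0 : 0 <= s by rewrite addr_ge0 ?sumnorm_ge0.
apply: (@mxcvg_squeeze _ _ _ _ (fun k => (2 * s ^+ 2 * expR s ^+ 2) / k.+1%:R)).
  move=> k; pose c : R := k.+1%:R^-1.
  have c0 : 0 < c by rewrite invr_gt0.
  have ck : c * k.+1%:R = 1 by rewrite mulVf.
  have -> : expmx (Y + Z) = expmx (c%:C%C *: (Y + Z)) ^+ k.+1.
    rewrite -expmxX; congr expmx; rewrite -scaler_nat scalerA.
    have -> : (k.+1%:R : R[i]) = (k.+1%:R : R)%:C%C by rewrite rmorph_nat.
    by rewrite -rmorphM /= mulrC ck rmorph1 scale1r.
  have cs0 : 0 <= s * c by rewrite mulr_ge0// ltW.
  have hb : near_one (s * c) (expmx (c%:C%C *: (Y + Z))).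
    rewrite /near_one (le_trans (expmx_near1 _))// lerD2r ler_expR.
    by rewrite sumnormZ gtr0_norm// mulrC ler_wpM2r ?(ltW c0)// sumnormD.
  rewrite (le_trans (sumnorm_subX k.+1 cs0 (lie_step_near_one Y Z k) hb))//.
  have := expmx_mul_taylor2 (c%:C%C *: Y) (c%:C%C *: Z).
  rewrite -scalerDr !sumnormZ !gtr0_norm// -mulrDr -/s /= => h.
  have -> : s * c *+ k.+1 = s by rewrite -mulr_natr -mulrA ck mulr1.
  have e0 := expR_gt0 s.
  have h2 : expR (c * s) <= expR s.
    rewrite ler_expR -[leRHS]mul1r ler_wpM2r// /c invf_le1 ?ler1n//.
  rewrite (@le_trans _ _ (k.+1%:R * expR s * (2 * (c * s) ^+ 2 * expR s)))//.
    rewrite ler_wpM2l ?mulr_ge0 ?expR_ge0// (le_trans h)//.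
    by rewrite ler_wpM2l// mulr_ge0// sqr_ge0.
  rewrite -/c le_eqVlt; apply/orP; left; apply/eqP.
  transitivity (c * k.+1%:R * (2 * s ^+ 2 * expR s ^+ 2 * c)); first by ring.
  by rewrite ck mul1r.
rewrite -[(0 : R)](mulr0 (2 * s ^+ 2 * expR s ^+ 2)).
apply: cvgM; first exact: cvg_cst.
exact: cvg_harmonic.
Qed.

End lie_product.

Lemma sub_common_head (W : zmodType) (x p q p' q' : W) :
  (x + p + q) - (x + p' + q') = (p - p') + (q - q').
Proof.
rewrite -(addrA x p) -(addrA x p') opprD addrACA subrr add0r.
by rewrite opprD addrACA.
Qed.

Section adjoint.
Variables (R : realType) (n : nat).
Implicit Types X Y : 'M[R[i]]_n.
Local Notation N := (@sumnorm R _ _).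

(** With [E = exp (tY)] and [E' = E^-1], the difference [X - E' X E] equals
    [E' (E X - X E)], and [E X - X E] is [t [Y, X]] up to second order. *)
Lemma adjoint_derivative X Y : exists2 K : R, 0 <= K & forall t : R,
  t != 0 -> `|t| <= 1 ->
  N ((t^-1)%:C%C *: (X - invmx (expmx (t%:C%C *: Y)) *m X *m expmx (t%:C%C *: Y))
     - lie_bracket Y X) <= K * `|t|.
Proof.
pose y := N Y; pose x := N X; pose b := N (lie_bracket Y X).
have y0 : 0 <= y := sumnorm_ge0 Y. have x0 : 0 <= x := sumnorm_ge0 X.
have b0 : 0 <= b := sumnorm_ge0 _.
exists (y * expR y * b + expR y * (2 * (y ^+ 2 * expR y * x))).
  by rewrite addr_ge0// !mulr_ge0 ?expR_ge0 ?sqr_ge0.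
move=> t t0 t1; rewrite expmx_inv.
set a := t%:C%C *: Y; pose E := expmx a; pose E' := expmx (- a).
pose r := E - 1 - a.
have Na : N a = `|t| * y by rewrite sumnormZ.
have ey : expR (`|t| * y) <= expR y by rewrite ler_expR ler_piMl.
have hr : N r <= `|t| ^+ 2 * (y ^+ 2 * expR y).
  rewrite (le_trans (expmx_taylor2 a))// Na exprMn -mulrA.
  by rewrite !ler_wpM2l ?sqr_ge0.
have hE' : N (E' - 1) <= `|t| * (y * expR y).
  rewrite (le_trans (expmx_near1 _))// sumnormN Na.
  have := expR_ge1Dx (- (`|t| * y)); rewrite expRN => h.
  have h2 : (1 - `|t| * y) * expR (`|t| * y) <= 1.
    by rewrite -ler_pdivlMr ?expR_gt0// mul1r.
  have h3 : `|t| * y * expR (`|t| * y) <= `|t| * y * expR y.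
    by rewrite ler_wpM2l// mulr_ge0.
  lra.
have near' : near_one y E'.
  rewrite /near_one (le_trans (expmx_near1 _))// sumnormN Na.
  by rewrite lerD2r.
have key : X - E' *m X *m E =
    t%:C%C *: lie_bracket Y X +
    ((E' - 1) *m (t%:C%C *: lie_bracket Y X) + E' *m (r *m X - X *m r)).
  have E'E : E' *m E = 1%:M by have := expmxN (- a); rewrite opprK.
  have -> : X - E' *m X *m E = E' *m (E *m X - X *m E).
    by rewrite mulmxBr !mulmxA E'E mul1mx.
  have -> : t%:C%C *: lie_bracket Y X = a *m X - X *m a.
    by rewrite /lie_bracket scalerBr -scalemxAl -scalemxAr.
  have -> : E *m X - X *m E = (a *m X - X *m a) + (r *m X - X *m r).
    have -> : E = 1%:M + a + r by rewrite /r -addrA subrKC subrKC.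
    rewrite !(mulmxDl, mulmxDr) mul1mx mulmx1.
    exact: sub_common_head.
  have split_id (P Q : 'M[R[i]]_n) :
      E' *m (P + Q) = P + ((E' - 1) *m P + E' *m Q).
    have -> : (E' - 1) *m P = E' *m P - P.
      by rewrite mulmxBl; congr (_ - _); exact: mul1mx.
    by rewrite mulmxDr addrA subrKC.
  exact: split_id.
have -> : (t^-1)%:C%C *: (X - E' *m X *m E) - lie_bracket Y X =
    (E' - 1) *m lie_bracket Y X + (t^-1)%:C%C *: (E' *m (r *m X - X *m r)).
  have tt : (t^-1)%:C%C * t%:C%C = 1 :> R[i].
    by rewrite -rmorphM /= mulVf// rmorph1.
  have cancel_t (P Q : 'M[R[i]]_n) : (t^-1)%:C%C *: (t%:C%C *: P +
      ((E' - 1) *m (t%:C%C *: P) + Q)) - P = (E' - 1) *m P + (t^-1)%:C%C *: Q.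
    by rewrite !scalerDr -scalemxAr !scalerA tt !scale1r addrAC subrr add0r.
  by rewrite key; exact: cancel_t.
rewrite (le_trans (sumnormD _ _))// mulrDl lerD//.
  rewrite (le_trans (sumnormM _ _))// (le_trans (ler_wpM2r b0 hE'))//.
  by rewrite le_eqVlt; apply/orP; left; apply/eqP; ring.
rewrite sumnormZ normfV ler_pdivrMl ?normr_gt0//.
rewrite (le_trans (near_one_mull _ near'))//.
rewrite [leRHS](_ : _ = expR y * (2 * (`|t| ^+ 2 * (y ^+ 2 * expR y) * x)));
  last by ring.
rewrite ler_wpM2l ?expR_ge0//.
have h1 := sumnormB (r *m X) (X *m r).
have h2 := sumnormM r X; have h3 := sumnormM X r.
have h4 := ler_wpM2r x0 hr.
rewrite -/x in h2 h3; rewrite mulrC in h3.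
lra.
Qed.

End adjoint.

(** * The Lie algebra of a closed matrix group *)

Section lie_algebra_facts.
Variables (R : realType) (n : nat) (G : set 'M[R[i]]_n).
Hypothesis lieG : matrix_lie_group G.
Local Notation N := (@sumnorm R _ _).

Lemma lie_group_unit g : G g -> g \in unitmx.
Proof. by case: lieG => -[] + _ _ _ _; exact. Qed.

Lemma lie_group1 : G 1%:M.
Proof. by case: lieG => -[]. Qed.

Lemma lie_groupM g h : G g -> G h -> G (g *m h).
Proof. by case: lieG => -[] _ _ + _ _; exact. Qed.

Lemma lie_groupV g : G g -> G (invmx g).
Proof. by case: lieG => -[] _ _ _ + _; exact. Qed.

Lemma lie_groupX g k : G g -> G (g ^+ k).
Proof.
move=> Gg; elim: k => [|k IH]; first exact: lie_group1.
by rewrite exprS; exact: lie_groupM.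
Qed.

(** The group is closed only relative to the general linear group, hence the
    assumption that the limit is invertible. *)
Lemma lie_group_cvg (u : nat -> 'M[R[i]]_n) E :
  (forall k, G (u k)) -> mxcvg u E -> E \in unitmx -> G E.
Proof.
move=> Gu uE Eu; have [_ [Z [clZ GZ]]] := lieG.
rewrite GZ; split => //; apply: clZ => U /nbhs_sumnormP[e e0 EU].
have /mxcvgP/(_ e e0)[k _ /(_ k (leqnn k)) uk] := uE.
by exists (u k); split; [have := Gu k; rewrite GZ => -[]|exact: EU].
Qed.

Lemma lie_algebra0 : lie_algebra G 0.
Proof. by move=> t; rewrite scaler0 expmx0; exact: lie_group1. Qed.

Lemma lie_algebraZ (a : R) Y : lie_algebra G Y -> lie_algebra G (a%:C%C *: Y).
Proof. by move=> gY t; rewrite scalerA -rmorphM; exact: gY. Qed.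

Lemma lie_step_group Y Z k : lie_algebra G Y -> lie_algebra G Z ->
  G (lie_step Y Z k).
Proof. by move=> gY gZ; apply: lie_groupM; [exact: gY|exact: gZ]. Qed.

Lemma lie_algebraD Y Z : lie_algebra G Y -> lie_algebra G Z ->
  lie_algebra G (Y + Z).
Proof.
move=> gY gZ t; rewrite scalerDr.
apply: lie_group_cvg (lie_product _ _) (expmx_unit _) => k.
by apply/lie_groupX/lie_step_group; exact: lie_algebraZ.
Qed.

Lemma lie_algebra_conj g Y : G g -> lie_algebra G Y ->
  lie_algebra G (invmx g *m Y *m g).
Proof.
move=> Gg gY t; rewrite scalemxAl scalemxAr expmx_conj ?lie_group_unit//.
by apply: lie_groupM => //; apply: lie_groupM; [exact: lie_groupV|exact: gY].
Qed.

End lie_algebra_facts.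

(** * First-order behaviour of curves *)

Section tangent.
Variables (R : realType) (V : normedModType R).
Implicit Types (c : R -> V) (w : V).

(** Clearing the denominator turns a difference quotient into a first-order
    estimate, which composes better. *)
Lemma cvg_quotientP (F : set_system R) {FF : Filter F} c (c0 w : V) :
  (\forall t \near F, t != 0) ->
  (t^-1 *: (c t - c0) @[t --> F] --> w) <->
  (forall e : R, 0 < e -> \forall t \near F, `|c t - c0 - t *: w| <= e * `|t|).
Proof.
move=> F0.
have E t : t != 0 -> `|c t - c0 - t *: w| = `|t| * `|w - t^-1 *: (c t - c0)|.
  move=> t0; rewrite -normrZ scalerBr scalerA mulfV// scale1r.
  by rewrite -[RHS]normrN opprB.
split=> [/cvgrPdist_le cw e e0|cw].
  near=> t; rewrite E; last by near: t.
  by rewrite mulrC ler_wpM2r//; near: t; exact: cw.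
apply/cvgrPdist_le => e e0; near=> t.
have t0 : t != 0 by near: t.
rewrite -(@ler_pM2l _ `|t|) ?normr_gt0// -E// mulrC.
by near: t; exact: cw.
Unshelve. all: by end_near.
Qed.

Definition tangent c w := forall e : R, 0 < e ->
  exists2 d : R, 0 < d &
    forall t, `|t| < d -> `|c t - c 0 - t *: w| <= e * `|t|.

Definition right_tangent c w := forall e : R, 0 < e ->
  exists2 d : R, 0 < d &
    forall t, 0 <= t < d -> `|c t - c 0 - t *: w| <= e * t.

Lemma tangentP c w : (t^-1 *: (c t - c 0) @[t --> 0^'] --> w) <-> tangent c w.
Proof.
rewrite cvg_quotientP; last exact: nbhs_dnbhs_neq.
split=> cw e e0.
  have /nbhs_ballP[d d0 dP] := cw e e0; exists d => // t td.
  have [->|t0] := eqVneq t 0.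
    by rewrite subrr scale0r subrr !normr0 mulr0.
  by apply: dP => //; rewrite /ball/= sub0r normrN.
have [d d0 dP] := cw e e0; apply/nbhs_ballP; exists d => // t.
by rewrite /ball/= sub0r normrN => td _; exact: dP.
Qed.

Lemma right_tangentP c w :
  (t^-1 *: (c t - c 0) @[t --> 0^'+] --> w) <-> right_tangent c w.
Proof.
rewrite cvg_quotientP; last exact: nbhs_right_neq.
split=> cw e e0.
  have /nbhs_ballP[d d0 dP] := cw e e0; exists d => // t /andP[t0 td].
  move: t0; rewrite le_eqVlt => /predU1P[<-|t0].
    by rewrite subrr scale0r subrr normr0 mulr0.
  have := dP t _ t0; rewrite /ball/= sub0r normrN (gtr0_norm t0).
  by apply.
have [d d0 dP] := cw e e0; apply/nbhs_ballP; exists d => // t.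
rewrite /ball/= sub0r normrN => td t0; rewrite (gtr0_norm t0).
by apply: dP; rewrite (ltW t0) -(gtr0_norm t0).
Qed.

Lemma tangentZ c w (a : R) : tangent c w -> tangent (fun t => c (t * a)) (a *: w).
Proof.
move=> cw e e0; have a1 : 0 < `|a| + 1 by rewrite ltr_wpDl.
have [d d0 dP] := cw (e / (`|a| + 1)) (divr_gt0 e0 a1).
exists (d / (`|a| + 1)); first exact: divr_gt0.
move=> t td; rewrite mul0r scalerA (le_trans (dP _ _))//.
  rewrite normrM; rewrite (le_lt_trans (y := `|t| * (`|a| + 1)))//.
    by rewrite ler_wpM2l// lerDl.
  by rewrite -ltr_pdivlMr.
rewrite normrM [leLHS](_ : _ = e * `|t| * (`|a| / (`|a| + 1))); last by ring.
by rewrite ler_piMr ?mulr_ge0 ?(ltW e0)// ler_pdivrMr// mul1r lerDl.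
Qed.

(** If one application of [P] moves [x] by almost [w], and the iterates of [P]
    hardly move [w], then [k] applications move [x] by almost [k w]: the
    [j]-th step contributes the [j]-th iterate applied to [P x - x]. *)
Lemma iter_drift (P : {linear V -> V}) (x w : V) (k : nat) (M dl : R) :
  (forall j, (j < k)%N -> forall y, `|iter j P y| <= M * `|y|) ->
  (forall j, (j < k)%N -> `|iter j P w - w| <= dl) ->
  `|iter k P x - x - k%:R *: w| <= k%:R * (M * `|P x - x - w| + dl).
Proof.
have iterB j a b : iter j P (a - b) = iter j P a - iter j P b.
  by elim: j => //= j ->; rewrite linearB.
elim: k => [_ _|k IH PM Pw].
  by rewrite /= subrr scale0r subrr normr0 mul0r.
have -> : iter k.+1 P x - x - k.+1%:R *: w =
    (iter k P x - x - k%:R *: w) + iter k P (P x - x - w) + (iter k P w - w).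
  rewrite !iterB -iterSr /= -nat1r scalerDl scale1r.
  move: (iter k P x) (iter k P w) (k%:R *: w) => a c d; move: (P a) => b.
  rewrite -[RHS]addrA subrKA [RHS]addrC [b - a - _]addrAC -(addrA a) subrKA.
  by rewrite opprD addrACA.
rewrite (le_trans (ler_normD _ _))// -natr1 mulrDl mul1r.
rewrite (le_trans (lerD (ler_normD _ _) (lexx _)))//.
rewrite -addrA lerD//; last by rewrite lerD ?PM ?Pw.
by apply: IH => j jk; [apply: PM|apply: Pw]; rewrite ltnS ltnW.
Qed.

End tangent.

(** * Generators of bounded semigroups *)

Section semigroup_generator.
Variables (R : realType) (V : normedModType R).
Variables (S : R -> {linear V -> V}) (B : partial_op V).
Hypotheses (semS : bounded_C0_semigroup S) (genS : generates B S).

Lemma generatorP phi psi :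
  (dom B phi /\ B phi = psi) <-> right_tangent (fun t => S t phi) psi.
Proof.
rewrite genS -right_tangentP; have [_ S0 _ _ _] := semS.
by rewrite S0.
Qed.

Lemma semigroup_iter r j phi : 0 <= r -> iter j (S r) phi = S (r *+ j) phi.
Proof.
move=> r0; have [_ S0 SD _ _] := semS.
elim: j => [|j IH]; first by rewrite mulr0n S0.
by rewrite iterS IH mulrS SD// mulrn_wge0.
Qed.

Lemma semigroup_bound : exists2 M : R, 0 <= M &
  forall t phi, 0 <= t -> `|S t phi| <= M * `|phi|.
Proof.
have [_ _ _ _ [M SM]] := semS; exists `|M| => // t phi t0.
by rewrite (le_trans (SM t phi t0))// ler_wpM2r// ler_norm.
Qed.

Lemma semigroup_cont0 phi (e : R) : 0 < e ->
  exists2 d : R, 0 < d & forall t, 0 <= t < d -> `|S t phi - phi| <= e.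
Proof.
move=> e0; have [_ S0 _ cS _] := semS.
have /cvgrPdist_le/(_ e e0)/nbhs_ballP[d d0 dP] := cS phi.
exists d => // t /andP[t0 td]; move: t0; rewrite le_eqVlt => /predU1P[<-|t0].
  by rewrite S0 subrr normr0 ltW.
rewrite distrC; apply: dP => //.
by rewrite /ball/= sub0r normrN gtr0_norm.
Qed.

(** Split [S t] into many steps of length [r]. For an approximating [x] in the
    domain one step is [r (B x)] up to [o(r)], so [iter_drift] compares [S t x
    - x] with [t psi] using only the strong continuity of the semigroup at
    [psi]. *)
Lemma generator_closed phi psi :
  (forall e : R, 0 < e -> exists2 x,
     dom B x & `|x - phi| <= e /\ `|B x - psi| <= e) ->
  dom B phi /\ B phi = psi.
Proof.
move=> approx; apply/generatorP => e e0.
have [_ S0 _ _ _] := semS.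
have [M M0 SM] := semigroup_bound.
have e2 : 0 < e / 2 by rewrite divr_gt0.
have [d d0 dP] := semigroup_cont0 psi e2.
exists d => // t /andP[t0 td]; rewrite S0.
move: t0; rewrite le_eqVlt => /predU1P[<-|t0].
  by rewrite S0 subrr scale0r subrr normr0 mulr0.
(* [K] collects all coefficients with which the approximation error [eta]
   enters. *)
pose K := 2 * M * t + M + 1.
have K0 : 0 < K by rewrite ltr_wpDl// addr_ge0// !mulr_ge0// ltW.
pose eta := t * (e / 2) / K.
have eta0 : 0 < eta by rewrite divr_gt0// mulr_gt0.
have [x Bx [xphi xpsi]] := approx eta eta0.
have /generatorP/(_ _ eta0)[d' d'0 d'P] : dom B x /\ B x = B x by [].
have [k kP] : exists k, t / k.+1%:R < d'.
  have [k _ kP] : \forall k \near \oo, t / k.+1%:R < d'.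
    have /cvgrPdist_lt/(_ _ (divr_gt0 d'0 t0)) := @cvg_harmonic R.
    apply: filterS => k; rewrite sub0r normrN ger0_norm ?invr_ge0//.
    by rewrite ltr_pdivlMr// mulrC.
  by exists k; apply: kP => /=.
set r := t / k.+1%:R in kP.
have r0 : 0 < r by rewrite divr_gt0.
have rk : k.+1%:R * r = t by rewrite mulrC divfK.
have drift : `|S t x - x - t *: psi| <= t * (M * (eta + eta) + e / 2).
  have -> : S t x = iter k.+1 (S r) x.
    by rewrite semigroup_iter ?(ltW r0)// -mulr_natl rk.
  rewrite -rk -scalerA.
  rewrite (le_trans
    (@iter_drift _ _ (S r) x (r *: psi) k.+1 M (r * (e / 2)) _ _))//.
  - by move=> j _ y; rewrite semigroup_iter ?(ltW r0)// SM// mulrn_wge0// ltW.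
  - move=> j jk; rewrite semigroup_iter ?(ltW r0)//.
    rewrite linearZ_LR -scalerBr normrZ gtr0_norm// ler_wpM2l ?(ltW r0)//.
    apply: dP; rewrite mulrn_wge0 ?(ltW r0)//= (le_lt_trans _ td)//.
    by rewrite -rk -(mulr_natl r j) ler_wpM2r ?(ltW r0)// ler_nat ltnW.
  - rewrite -mulrA ler_wpM2l// mulrDr lerD2r mulrCA ler_wpM2l//.
    have -> : S r x - x - r *: psi = (S r x - x - r *: B x) + r *: (B x - psi).
      by rewrite scalerBr addrA subrK.
    rewrite (le_trans (ler_normD _ _))// mulrDr lerD//.
      have := d'P r; rewrite S0 mulrC; apply.
      by rewrite (ltW r0).
    by rewrite normrZ gtr0_norm// ler_wpM2l// ltW.
have -> : S t phi - phi - t *: psi =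
    (S t x - x - t *: psi) + (x - phi) - S t (x - phi).
  rewrite linearB /= opprB.
  have E (a b c g f : V) : a - b - f = (c - g - f) + (g - b) + (a - c).
    by rewrite [c - g - f]addrAC subrKA [RHS]addrC -(addrA c) subrKA addrA addrAC.
  exact: E.
have h1 := ler_normB ((S t x - x - t *: psi) + (x - phi)) (S t (x - phi)).
have h2 := ler_normD (S t x - x - t *: psi) (x - phi).
have h3 := SM t (x - phi) (ltW t0).
have h4 := ler_wpM2l M0 xphi.
have h5 : eta * K = t * (e / 2) by rewrite divfK// gt_eqF.
rewrite /K in h5.
have h6 : e * t = t * (e / 2) + t * (e / 2) by field.
lra.
Qed.

(** A generator is the limit of linear difference quotients. *)
Lemma generator_linear (a : R) x y : dom B x -> dom B y ->
  dom B (a *: x + y) /\ B (a *: x + y) = a *: B x + B y.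
Proof.
move=> Bx By; apply/genS.
have /genS cx : dom B x /\ B x = B x by [].
have /genS cy : dom B y /\ B y = B y by [].
have -> : (fun t => t^-1 *: (S t (a *: x + y) - (a *: x + y))) =
    (fun t => a *: (t^-1 *: (S t x - x)) + t^-1 *: (S t y - y)).
  apply/funext => t; rewrite linearP scalerA mulrC -scalerA -scalerDr.
  by congr (_ *: _); rewrite scalerBr opprD addrACA.
by apply: cvgD => //; exact: cvgZr.
Qed.

End semigroup_generator.

(** * Orbits of a bounded representation *)

(** The product rule: first [z] replaces [phi] up to first order, then [P]
    acts. *)
Lemma first_order_comp (R : realType) (V : normedModType R)
    (P : {linear V -> V}) (z phi wY wZ : V) (t M e : R) :
  0 <= M -> (forall x, `|P x| <= M * `|x|) ->
  `|z - phi - t *: wZ| <= e * `|t| -> `|P phi - phi - t *: wY| <= e * `|t| ->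
  `|P wZ - wZ| <= e ->
  `|P z - phi - t *: (wY + wZ)| <= e * (M + 2) * `|t|.
Proof.
move=> M0 PM hZ hY hd.
have -> : P z - phi - t *: (wY + wZ) =
   P (z - phi - t *: wZ) + t *: (P wZ - wZ) + (P phi - phi - t *: wY).
  rewrite scalerBr scalerDr !linearB [P (t *: wZ)]linearZ_LR.
  move: (P z) (P phi) (t *: P wZ) (t *: wZ) (t *: wY) => a b c x y.
  rewrite subrKA [a - b - x]addrAC -[b - _ - _]addrA subrKA.
  by rewrite [RHS]addrACA -opprD (addrC x).
have h1 := ler_normD (P (z - phi - t *: wZ) + t *: (P wZ - wZ))
  (P phi - phi - t *: wY).
have h2 := ler_normD (P (z - phi - t *: wZ)) (t *: (P wZ - wZ)).
have h3 := PM (z - phi - t *: wZ).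
have h4 := ler_wpM2l M0 hZ.
have h5 : `|t *: (P wZ - wZ)| <= e * `|t|.
  by rewrite normrZ mulrC ler_wpM2r.
lra.
Qed.

Section representation.
Variables (R : realType) (V : normedModType R) (n : nat).
Variables (G : set 'M[R[i]]_n) (Pi : 'M[R[i]]_n -> {linear V -> V}).
Hypotheses (lieG : matrix_lie_group G) (repPi : bounded_representation G Pi).
Implicit Types (Y Z g : 'M[R[i]]_n) (phi w : V).
Local Notation N := (@sumnorm R _ _).

Lemma rep1 phi : Pi 1%:M phi = phi.
Proof. by case: repPi. Qed.

Lemma repM g h phi : G g -> G h -> Pi (g *m h) phi = Pi g (Pi h phi).
Proof. by case: repPi => _ _ + _ _; exact. Qed.

Lemma repK g phi : G g -> Pi (invmx g) (Pi g phi) = phi.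
Proof.
move=> Gg; rewrite -repM ?mulVmx ?rep1//; last exact: lie_groupV.
exact: lie_group_unit Gg.
Qed.

Lemma rep_iter g j phi : G g -> iter j (Pi g) phi = Pi (g ^+ j) phi.
Proof.
move=> Gg; elim: j => [|j IH]; first by rewrite expr0 rep1.
by rewrite iterS IH exprS -mulmxE repM//; exact: lie_groupX.
Qed.

Lemma rep_bound : exists2 M : R, 0 <= M &
  forall g phi, G g -> `|Pi g phi| <= M * `|phi|.
Proof.
have [_ _ _ _ [M PM]] := repPi; exists `|M| => // g phi Gg.
by rewrite (le_trans (PM g phi Gg))// ler_wpM2r// ler_norm.
Qed.

Lemma rep_cont g phi (e : R) : G g -> 0 < e ->
  exists2 d : R, 0 < d &
    forall h, G h -> N (h - g) < d -> `|Pi h phi - Pi g phi| <= e.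
Proof.
move=> Gg e0; have [_ _ _ /(_ phi)/subspace_continuousP/(_ g Gg) + _] := repPi.
move/cvgrPdist_le/(_ e e0)/nbhs_sumnormP => [d d0 dP].
by exists d => // h Gh hg; rewrite distrC; exact: dP.
Qed.

(** In this form strong continuity applies to all powers of a matrix at once,
    through [near_oneX]. *)
Lemma rep_cont1 phi (e : R) : 0 < e ->
  exists2 d : R, 0 < d &
    forall a h, G h -> a <= d -> near_one a h -> `|Pi h phi - phi| <= e.
Proof.
move=> e0; have [d d0 dP] := rep_cont phi (lie_group1 lieG) e0.
have /cvgrPdist_lt/(_ d d0)/nbhs_ballP[r r0 rP] := @continuous_expR R 0.
exists (r / 2); first by rewrite divr_gt0.
move=> a h Gh ar ha; rewrite -[in X in _ - X](rep1 phi); apply: dP => //.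
rewrite (le_lt_trans ha)//; have r2 : 0 < r / 2 by rewrite divr_gt0.
rewrite (@le_lt_trans _ _ (expR (r / 2) - 1))// ?lerD2r ?ler_expR//.
have := rP (r / 2); rewrite /ball/= sub0r normrN gtr0_norm//.
rewrite gtr_pMr// invf_lt1 ?ltr1n// expR0 distrC => /(_ isT).
by rewrite gtr0_norm// subr_gt0 expR_gt1.
Qed.

Lemma rep_mxcvg (h : nat -> 'M[R[i]]_n) g phi (e : R) :
  (forall k, G (h k)) -> G g -> mxcvg h g -> 0 < e ->
  \forall k \near \oo, `|Pi (h k) phi - Pi g phi| <= e.
Proof.
move=> Gh Gg /mxcvgP hg e0; have [d d0 dP] := rep_cont phi Gg e0.
by apply: filterS (hg d d0) => k; exact: dP.
Qed.

Definition orbit_curve Y phi (t : R) : V := Pi (expmx (t%:C%C *: Y)) phi.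

Lemma orbit_curve0 Y phi : orbit_curve Y phi 0 = phi.
Proof. by rewrite /orbit_curve scale0r expmx0 rep1. Qed.

Lemma pi_opP Y phi w :
  (dom (pi_op Pi Y) phi /\ pi_op Pi Y phi = w) <->
  tangent (orbit_curve Y phi) w.
Proof.
rewrite -tangentP orbit_curve0; split=> [[+ <-]|cw]; first by [].
split; first by apply/cvg_ex; exists w.
by apply: cvg_lim; first exact: norm_hausdorff.
Qed.

Lemma tangent_orbitZ (a : R) Y phi w : tangent (orbit_curve Y phi) w ->
  tangent (orbit_curve (a%:C%C *: Y) phi) (a *: w).
Proof.
have -> : orbit_curve (a%:C%C *: Y) phi = fun t => orbit_curve Y phi (t * a).
  by apply/funext => t; rewrite /orbit_curve scalerA rmorphM.
exact: tangentZ.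
Qed.

(** Since [exp (tY) g = g exp (t g^-1 Y g)], the bounded operator of [g]
    carries one orbit to the other. *)
Lemma tangent_orbit_conj g Y phi w : G g -> lie_algebra G Y ->
  tangent (orbit_curve (invmx g *m Y *m g) phi) w ->
  tangent (orbit_curve Y (Pi g phi)) (Pi g w).
Proof.
move=> Gg gY cw e e0; have [M M0 PM] := rep_bound.
have M1 : 0 < M + 1 by rewrite ltr_wpDl.
have [d d0 dP] := cw (e / (M + 1)) (divr_gt0 e0 M1).
have ug := lie_group_unit lieG Gg.
exists d => // t td.
have -> : orbit_curve Y (Pi g phi) t - orbit_curve Y (Pi g phi) 0 - t *: Pi g w
  = Pi g (orbit_curve (invmx g *m Y *m g) phi t -
          orbit_curve (invmx g *m Y *m g) phi 0 - t *: w).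
  rewrite !orbit_curve0.
  have -> : orbit_curve Y (Pi g phi) t =
      Pi g (orbit_curve (invmx g *m Y *m g) phi t).
    rewrite /orbit_curve scalemxAl scalemxAr expmx_conj// -!repM//.
    - by rewrite !mulmxA mulmxV// mul1mx.
    - apply: lie_groupM => //; apply: lie_groupM => //.
      exact: lie_groupV.
  move: (orbit_curve _ _ _) (Pi g) => c P.
  by rewrite !linearB [P (t *: w)]linearZ_LR.
rewrite (le_trans (PM _ _ Gg))// (le_trans (ler_wpM2l M0 (dP t td)))//.
rewrite mulrA ler_wpM2r// mulrCA ler_piMr ?(ltW e0)//.
by rewrite ler_pdivrMr// mul1r lerDl.
Qed.

Lemma tangent_orbit_mul Y Z phi wY wZ :
  lie_algebra G Y -> lie_algebra G Z ->
  tangent (orbit_curve Y phi) wY -> tangent (orbit_curve Z phi) wZ ->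
  forall e : R, 0 < e -> exists2 d : R, 0 < d & forall t, `|t| < d ->
    `|Pi (expmx (t%:C%C *: Y) *m expmx (t%:C%C *: Z)) phi - phi
      - t *: (wY + wZ)| <= e * `|t|.
Proof.
move=> gY gZ cY cZ e e0; have [M M0 PM] := rep_bound.
have M2 : 0 < M + 2 by rewrite ltr_wpDl.
pose e' := e / (M + 2); have e'0 : 0 < e' by rewrite divr_gt0.
have [dY dY0 dYP] := cY _ e'0; have [dZ dZ0 dZP] := cZ _ e'0.
have [d d0 dP] := rep_cont1 wZ e'0.
have Y1 : 0 < N Y + 1 by rewrite ltr_wpDl// sumnorm_ge0.
exists (Num.min (d / (N Y + 1)) (Num.min dY dZ)).
  by rewrite !lt_min dY0 dZ0 divr_gt0.
move=> t; rewrite !lt_min => /and3P[td tdY tdZ].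
have := dYP t tdY; have := dZP t tdZ; rewrite !orbit_curve0 /orbit_curve => hZ hY.
have {dP} hd : `|Pi (expmx (t%:C%C *: Y)) wZ - wZ| <= e'.
  apply: (dP (`|t| * N Y)) => //.
    have := ltW td; rewrite ler_pdivlMr// => /(le_trans _); apply.
    by rewrite ler_wpM2l// lerDl.
  by rewrite /near_one (le_trans (expmx_near1 _))// sumnormZ.
have e'E : e = e' * (M + 2) by rewrite divfK// gt_eqF.
rewrite repM// e'E; apply: first_order_comp => // x.
by apply: PM; exact: gY.
Qed.

(** By the Lie product formula [exp (t (Y + Z))] is the limit of [h k ^+
    k.+1], where [h k] is the product of the exponentials of [tY] and [tZ]
    divided by [k.+1]. One step [h k] moves [phi] by almost [(t / k.+1) w],
    and all powers of [h k] up to [k.+1] stay near the identity uniformly in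
    [k], so they hardly move [w]. *)
Lemma tangent_orbitD Y Z phi wY wZ :
  lie_algebra G Y -> lie_algebra G Z ->
  tangent (orbit_curve Y phi) wY -> tangent (orbit_curve Z phi) wZ ->
  tangent (orbit_curve (Y + Z) phi) (wY + wZ).
Proof.
move=> gY gZ cY cZ e e0; have [M M0 PM] := rep_bound.
set w := wY + wZ; pose s := N Y + N Z.
have s0 : 0 <= s by rewrite addr_ge0 ?sumnorm_ge0.
have s1 : 0 < s + 1 by rewrite ltr_wpDl.
have e2 : 0 < e / 2 by rewrite divr_gt0.
have [d d0 dP] := rep_cont1 w e2.
exists (d / (s + 1)); first by rewrite divr_gt0.
move=> t; rewrite ltr_pdivlMr// => td; rewrite orbit_curve0 /orbit_curve.
have [->|t0] := eqVneq t 0.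
  by rewrite scale0r expmx0 rep1 subrr scale0r subrr !normr0 mulr0.
have nt0 : 0 < `|t| by rewrite normr_gt0.
apply/ler_addgt0Pl => e1 e10.
(* Half of [e] pays for the error of the single steps, which [M] amplifies,
   and half for the displacement of [w]. *)
have M4 : 0 < 2 * (M + 1) by rewrite mulr_gt0// ltr_wpDl.
have [d' d'0 d'P] := tangent_orbit_mul gY gZ cY cZ (divr_gt0 e0 M4).
pose h k := lie_step (t%:C%C *: Y) (t%:C%C *: Z) k.
have gtY := lie_algebraZ t gY; have gtZ := lie_algebraZ t gZ.
have Gh k : G (h k) by exact: lie_step_group.
have Gexp : G (expmx (t%:C%C *: (Y + Z))) by exact: lie_algebraD.
have hcvg : mxcvg (fun k => h k ^+ k.+1) (expmx (t%:C%C *: (Y + Z))).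
  by rewrite scalerDr; exact: lie_product.
have hN k : near_one ((N (t%:C%C *: Y) + N (t%:C%C *: Z)) / k.+1%:R) (h k).
  exact: lie_step_near_one.
have hE k : h k = expmx ((t / k.+1%:R)%:C%C *: Y) *m
                  expmx ((t / k.+1%:R)%:C%C *: Z).
  by rewrite /h /lie_step !scalerA -!rmorphM /= mulrC.
clearbody h.
have near1 := rep_mxcvg phi (fun k => lie_groupX lieG k.+1 (Gh k)) Gexp hcvg e10.
have near2 : \forall k \near \oo, `|t| / k.+1%:R < d'.
  have /cvgrPdist_lt/(_ _ (divr_gt0 d'0 nt0)) := @cvg_harmonic R.
  apply: filterS => k; rewrite sub0r normrN ger0_norm ?invr_ge0//.
  by rewrite ltr_pdivlMr// mulrC.
near \oo => k.
have h1 : `|Pi (h k ^+ k.+1) phi - Pi (expmx (t%:C%C *: (Y + Z))) phi| <= e1.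
  by near: k; exact: near1.
have h2 : `|t| / k.+1%:R < d' by near: k; exact: near2.
pose r := t / k.+1%:R.
have nr : `|r| = `|t| / k.+1%:R by rewrite normrM [X in _ * X]ger0_norm ?invr_ge0.
have rk : k.+1%:R * r = t by rewrite mulrC divfK.
have hstep := d'P r; rewrite nr -hE in hstep; have {hstep} := hstep h2.
rewrite -/w -nr => hstep.
have drift : `|Pi (h k ^+ k.+1) phi - phi - t *: w| <=
    k.+1%:R * (M * `|Pi (h k) phi - phi - r *: w| + `|r| * (e / 2)).
  have -> : t *: w = k.+1%:R *: (r *: w) by rewrite scalerA rk.
  rewrite -(rep_iter _ _ (Gh k)).
  apply: (@iter_drift _ _ (Pi (h k)) phi (r *: w) k.+1 M) => [j _ y|j jk].
    rewrite (rep_iter _ _ (Gh k)).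
    exact: PM _ _ (lie_groupX lieG j (Gh k)).
  rewrite (rep_iter _ _ (Gh k)).
  rewrite [Pi _ (r *: w)]linearZ_LR -scalerBr normrZ ler_wpM2l//.
  apply: (dP ((N (t%:C%C *: Y) + N (t%:C%C *: Z)) / k.+1%:R *+ j)).
  - exact: lie_groupX.
  - rewrite !sumnormZ -mulrDr -/s -mulr_natr -mulrA.
    rewrite (@le_trans _ _ (`|t| * s))//.
      rewrite ler_piMr ?mulr_ge0// mulrC ler_pdivrMr// mul1r ler_nat.
      exact: ltnW.
    by rewrite (le_trans _ (ltW td))// ler_wpM2l// lerDl.
  - exact: near_oneX.
have h3 : k.+1%:R * (M * `|Pi (h k) phi - phi - r *: w| + `|r| * (e / 2)) <=
    e * `|t|.
  have tr : `|t| = k.+1%:R * `|r| by rewrite nr mulrC divfK.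
  rewrite tr [leRHS]mulrCA ler_wpM2l//.
  have h4 := ler_wpM2l M0 hstep.
  have h5 : M * (e / (2 * (M + 1)) * `|r|) <= e / 2 * `|r|.
    rewrite mulrA ler_wpM2r//.
    have -> : M * (e / (2 * (M + 1))) = (e / 2) * (M / (M + 1)).
      by field; rewrite gt_eqF// ltr_wpDl.
    by rewrite ler_piMr ?(ltW e2)// ler_pdivrMr ?ltr_wpDl// mul1r lerDl.
  have h6 : e * `|r| = e / 2 * `|r| + `|r| * (e / 2) by field.
  lra.
have -> : Pi (expmx (t%:C%C *: (Y + Z))) phi - phi - t *: w =
    (Pi (h k ^+ k.+1) phi - phi - t *: w) -
    (Pi (h k ^+ k.+1) phi - Pi (expmx (t%:C%C *: (Y + Z))) phi).
  move: (Pi (h k ^+ k.+1) phi) (Pi (expmx _) phi) => a b.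
  by rewrite opprB [RHS]addrC -[a - _ - _]addrA subrKA addrA.
rewrite (le_trans (ler_normB _ _))// addrC lerD//.
exact: le_trans drift h3.
Unshelve. all: by end_near.
Qed.

End representation.

Lemma orbit_curveD (R : realType) (V : normedModType R) n
    (G : set 'M[R[i]]_n) (Pi : 'M[R[i]]_n -> {linear V -> V}) Y phi (s t : R) :
  bounded_representation G Pi -> lie_algebra G Y ->
  orbit_curve Pi Y phi (s + t) =
  Pi (expmx (t%:C%C *: Y)) (orbit_curve Pi Y phi s).
Proof.
move=> repPi gY; rewrite /orbit_curve.
have -> : expmx ((s + t)%:C%C *: Y) =
    expmx (t%:C%C *: Y) *m expmx (s%:C%C *: Y).
  rewrite addrC rmorphD scalerDl expmxD//.
  by rewrite /GRing.comm -!mulmxE -!scalemxAl -!scalemxAr !scalerA mulrC.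
exact: (repM repPi phi (gY t) (gY s)).
Qed.

(** * Linear maps out of finite-dimensional spaces *)

Section finite_dimension.
Variables (R : realType) (m : nat).
Implicit Types (v w : 'rV[R]_m).

(** A matrix of largest rank among those whose rows span a part of [W]: adding
    one more vector of [W] to its rows cannot increase the rank. *)
Lemma row_subspace_mx (W : set 'rV[R]_m) :
  W 0 -> (forall (a : R) x y, W x -> W y -> W (a *: x + y)) ->
  exists B : 'M[R]_m, forall v, W v <-> (v <= B)%MS.
Proof.
move=> W0 WP.
pose P k := `[< exists B : 'M[R]_m, \rank B = k /\
  forall v, (v <= B)%MS -> W v >].
have P0 : exists k, P k.
  exists 0%N; apply/asboolP; exists 0; split; first by rewrite mxrank0.
  by move=> v; rewrite submx0 => /eqP ->.
have Pm k : P k -> (k <= m)%N by move/asboolP => [B [<- _]]; exact: rank_leq_row.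
have [k /asboolP[B [Bk BW]] kmax] := ex_maxnP P0 Pm.
exists B => v; split=> [Wv|]; last exact: BW.
suff : (\rank (B + v)%MS <= \rank B)%N.
  by rewrite (geq_leqif (mxrank_leqif_sup (addsmxSl B v))) addsmx_sub => /andP[].
rewrite Bk; apply: kmax; apply/asboolP; exists (B + v)%MS; split => //.
move=> x /sub_addsmxP[[a b] /= ->].
rewrite [b]mx11_scalar mul_scalar_mx addrC; apply: WP => //.
by apply: BW; exact: submxMl.
Qed.

Lemma norm_row_le v j : `|v 0 j| <= `|v|.
Proof.
rewrite [leRHS]/Num.Def.normr /= mx_normrE.
exact: (le_bigmax _ (fun ij : 'I_1 * 'I_m => `|v ij.1 ij.2|) (0, j)).
Qed.

Variable V : normedModType R.
Implicit Types (L K : {linear 'rV[R]_m -> V}).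

Lemma row_linear_bounded L :
  exists2 C : R, 0 <= C & forall v, `|L v| <= C * `|v|.
Proof.
exists (\sum_j `|L (delta_mx 0 j)|); first by rewrite sumr_ge0.
move=> v; rewrite {1}[v]row_sum_delta linear_sum (le_trans (ler_norm_sum _ _ _))//.
rewrite mulr_suml ler_sum// => j _.
by rewrite [L (_ *: _)]linearZ_LR normrZ mulrC ler_wpM2l// norm_row_le.
Qed.

Lemma row_linear_continuous L : continuous L.
Proof.
have [C C0 LC] := row_linear_bounded L.
apply/bounded_linear_continuous/linear_boundedP.
exists C; split; first exact: num_real.
by move=> r Cr v; rewrite (le_trans (LC v))// ler_wpM2r// ltW.
Qed.

End finite_dimension.

Section finite_rank_bound.
Variables (R : realType) (m : nat) (V : normedModType R).
Implicit Types (L K : {linear 'rV[R]_m -> V}).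

(** The image of the unit sphere of the row space is compact and avoids 0. *)
Lemma row_linear_lower_bound L (Q : 'M[R]_m) :
  (forall v, (v <= Q)%MS -> L v = 0 -> v = 0) ->
  exists2 c : R, 0 < c & forall v, (v <= Q)%MS -> c * `|v| <= `|L v|.
Proof.
move=> LQ.
pose Sph : set 'rV[R]_m := [set v | (v <= Q)%MS /\ `|v| = 1].
have Sc : compact Sph.
  apply: bounded_closed_compact.
    exists 1; split => // x x1 v [_ v1] /=.
    by rewrite v1 ltW.
  apply: closedI; last first.
    apply: (@closed_comp _ _ (fun v : 'rV[R]_m => `|v|) [set 1]).
      by move=> v _; exact: norm_continuous.
    exact: closed_eq.
  have QE : (fun v => mulmxr (cokermx Q) v) @^-1` [set 0] =
      [set v : 'rV[R]_m | (v <= Q)%MS].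
    by apply/seteqP; split => v /=; rewrite submxE => /eqP.
  have : closed ((fun v => mulmxr (cokermx Q) v) @^-1` [set (0 : 'rV[R]_m)]).
    apply: closed_comp; last first.
      exact: (accessible_closed_set1 (hausdorff_accessible (@norm_hausdorff _ _))).

    by move=> v _; exact: row_linear_continuous.
  by rewrite QE.
pose f v := `|L v|.
have fc : continuous f.
  move=> v; apply: continuous_comp; first exact: row_linear_continuous.
  exact: norm_continuous.
have cf : compact (f @` Sph).
  apply: continuous_compact => //; exact: continuous_subspaceT.
have clf := compact_closed (@Rhausdorff R) cf.
have f0 : (~` (f @` Sph)) 0.
  move=> [v [vQ v1]] /eqP; rewrite normr_eq0 => /eqP /(LQ v vQ) v0.
  by move: v1; rewrite v0 normr0 => /esym/eqP; rewrite oner_eq0.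
have /nbhs_ballP[c c0 cP] : nbhs 0 (~` (f @` Sph)).
  by apply: open_nbhs_nbhs; split => //; exact: closed_openC.
exists c => // v vQ; have [->|v0] := eqVneq v 0; first by rewrite normr0 mulr0.
have nv : 0 < `|v| by rewrite normr_gt0.
have S1 : Sph (`|v|^-1 *: v).
  split; first exact: scalemx_sub.
  by rewrite normrZ ger0_norm ?invr_ge0// mulVf ?gt_eqF.
rewrite leNgt; apply/negP => lt; apply: (cP (f (`|v|^-1 *: v))).
  rewrite /ball/= sub0r normrN /f normr_id [L _]linearZ_LR normrZ.
  by rewrite ger0_norm ?invr_ge0// mulrC ltr_pdivrMr.
by exists (`|v|^-1 *: v).
Qed.

(** On a complement of the kernel of [L] the norm of [L v] dominates that of
    [v], and both maps ignore the component in the kernel. *)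
Lemma row_linear_factor_bound L K : (forall v, L v = 0 -> K v = 0) ->
  exists M : R, forall v, `|K v| <= M * `|L v|.
Proof.
move=> LK.
have [||B BP] := @row_subspace_mx R m [set v | L v = 0].
- exact: linear0.
- by move=> a x y /= Lx Ly; rewrite linearP Lx Ly scaler0 addr0.
have [c c0 cP] : exists2 c : R, 0 < c &
    forall v, (v <= B^C)%MS -> c * `|v| <= `|L v|.
  apply: row_linear_lower_bound => v vB /BP vB'; apply/eqP.
  by rewrite -submx0 -(capmx_compl B) sub_capmx vB' vB.
have [C C0 KC] := row_linear_bounded K.
exists (C / c) => v.
have : (v <= B + B^C)%MS by rewrite submx_full// addsmx_compl_full.
move=> /sub_addsmxP[[a b] /= ->].
have La : L (a *m B) = 0 by apply/BP; exact: submxMl.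
rewrite !linearD La (LK _ La) !add0r.
rewrite (le_trans (KC _))// -mulrA ler_wpM2l// mulrC ler_pdivlMr// mulrC.
by apply: cP; exact: submxMl.
Qed.

End finite_rank_bound.

Section real_coordinates.
Variables (R : realType) (n : nat).
Local Notation D := (n * n + n * n)%N.

(** Coordinates over the reals: the Lie algebra need not be closed under
    multiplication by complex scalars. *)
Definition of_coord (v : 'rV[R]_D) : 'M[R[i]]_n := \matrix_(i, j)
  Complex (vec_mx (lsubmx v) i j) (vec_mx (rsubmx v) i j).

Definition to_coord (Y : 'M[R[i]]_n) : 'rV[R]_D :=
  row_mx (mxvec (map_mx (@complex.Re R) Y)) (mxvec (map_mx (@complex.Im R) Y)).

Lemma to_coordK : cancel to_coord of_coord.
Proof.
move=> Y; apply/matrixP => i j; rewrite mxE row_mxKl row_mxKr !mxvecK !mxE.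
by case: (Y i j).
Qed.

Lemma of_coordK : cancel of_coord to_coord.
Proof.
move=> v; rewrite -[RHS]hsubmxK; congr row_mx.
  by rewrite -[RHS]vec_mxK; congr mxvec; apply/matrixP => i j; rewrite !mxE.
by rewrite -[RHS]vec_mxK; congr mxvec; apply/matrixP => i j; rewrite !mxE.
Qed.

Lemma of_coord_linear (a : R) x y :
  of_coord (a *: x + y) = a%:C%C *: of_coord x + of_coord y.
Proof.
apply/matrixP => i j; rewrite !mxE; apply/eqP.
by rewrite eq_complex /= !mul0r subr0 addr0 !eqxx.
Qed.

Lemma to_coord_linear (a : R) Y Z :
  to_coord (a%:C%C *: Y + Z) = a *: to_coord Y + to_coord Z.
Proof. by apply: (can_inj of_coordK); rewrite of_coord_linear !to_coordK. Qed.

Lemma to_coord_le Y : `|to_coord Y| <= sumnorm Y.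
Proof.
rewrite [leLHS]/Num.Def.normr /= mx_normrE; apply: bigmax_le; first exact: sumnorm_ge0.
move=> [i j] _ /=; rewrite ord1 mxE.
case: (fintype.split j) => k; case/mxvec_indexP: k => p q; rewrite mxvecE mxE.
  exact: le_trans (le_Re_normc _) (le_normc_sumnorm _ _ _).
exact: le_trans (le_Im_normc _) (le_normc_sumnorm _ _ _).
Qed.

End real_coordinates.

Section real_subspace.
Variables (R : realType) (n : nat) (W : set 'M[R[i]]_n).
Hypotheses (W0 : W 0)
  (WP : forall (a : R) Y Z, W Y -> W Z -> W (a%:C%C *: Y + Z)).
Local Notation N := (@sumnorm R _ _).
Local Notation D := (n * n + n * n)%N.

Lemma subspace_projection : exists Q : 'M[R]_D,
  (forall v, W (of_coord (v *m Q))) /\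
  (forall Y, W Y -> to_coord Y *m Q = to_coord Y).
Proof.
have [||B BP] := @row_subspace_mx R D [set v | W (of_coord v)].
- by rewrite /= (_ : of_coord 0 = 0)//; apply/matrixP => i j; rewrite !mxE.
- by move=> a x y /= Wx Wy; rewrite of_coord_linear; exact: WP.
exists (pinvmx B *m B); split=> [v|Y WY].
  by apply/BP; rewrite mulmxA submxMl.
by rewrite mulmxA mulmxKpV//; apply/BP; rewrite /= to_coordK.
Qed.

(** Membership is the vanishing of a bounded linear map of the coordinates. *)
Lemma subspace_closed Z :
  (forall e : R, 0 < e -> exists2 Y, W Y & N (Y - Z) <= e) -> W Z.
Proof.
move=> appr; have [Q [WQ QW]] := subspace_projection.
suff ZQ : to_coord Z *m Q = to_coord Z by rewrite -(to_coordK Z) -ZQ.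
have [C C0 CP] := @row_linear_bounded R D _ (mulmxr (1%:M - Q)).
apply/eqP; rewrite eq_sym -subr_eq0 -[X in X - _]mulmx1 -mulmxBr -normr_le0.
apply/ler_addgt0Pl => e e0; rewrite addr0.
have C1 : 0 < C + 1 by rewrite ltr_wpDl.
have [Y WY YZ] := appr _ (divr_gt0 e0 C1).
have -> : to_coord Z *m (1%:M - Q) = - (to_coord (Y - Z) *m (1%:M - Q)).
  have -> : to_coord (Y - Z) = to_coord Y - to_coord Z.
    have := to_coord_linear (-1) Z Y.
    by rewrite rmorphN rmorph1 !scaleN1r addrC => ->; rewrite addrC.
  by rewrite mulmxBl [to_coord Y *m _]mulmxBr QW// mulmx1 subrr sub0r opprK.
rewrite normrN (le_trans (CP _))//.
rewrite (le_trans (ler_wpM2l C0 (le_trans (to_coord_le _) YZ)))//.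
by rewrite mulrCA ler_piMr ?(ltW e0)// ler_pdivrMr// mul1r lerDl.
Qed.

Variables (V : normedModType R) (T : 'M[R[i]]_n -> V).
Hypothesis TP : forall (a : R) Y Z, W Y -> W Z ->
  T (a%:C%C *: Y + Z) = a *: T Y + T Z.

(** Composing with the projection makes a map that is linear only on [W]
    linear on all coordinate vectors, without enlarging its image. *)
Lemma subspace_linear_extension : exists L : {linear 'rV[R]_D -> V},
  (forall v, exists2 Y, W Y & L v = T Y) /\
  (forall Y, W Y -> L (to_coord Y) = T Y).
Proof.
have [Q [WQ QW]] := subspace_projection.
pose f v := T (of_coord (v *m Q)).
have fl : linear f.
  by move=> a x y; rewrite /f mulmxDl -scalemxAl of_coord_linear TP.
pose L : {linear 'rV[R]_D -> V} :=
  HB.pack f (GRing.isLinear.Build R 'rV[R]_D V *:%R f fl).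
exists L; split=> [v|Y WY]; first by exists (of_coord (v *m Q)).
by rewrite /L /= /f QW// to_coordK.
Qed.

Lemma subspace_linear_bounded :
  exists2 C : R, 0 <= C & forall Y, W Y -> `|T Y| <= C * N Y.
Proof.
have [L [_ LT]] := subspace_linear_extension.
have [C C0 LC] := row_linear_bounded L.
exists C => // Y WY; rewrite -LT// (le_trans (LC _))//.
by rewrite ler_wpM2l// to_coord_le.
Qed.

Lemma subspace_image_bounded (K : V -> V) :
  (forall (a : R) Y Z, W Y -> W Z ->
    K (a *: T Y + T Z) = a *: K (T Y) + K (T Z)) ->
  exists M : R, forall Y, W Y -> `|K (T Y)| <= M * `|T Y|.
Proof.
move=> KP; have [L [TL LT]] := subspace_linear_extension.
pose f v := K (L v).
have fl : linear f.
  move=> a x y; rewrite /f linearP.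
  by have [Y WY ->] := TL x; have [Z WZ ->] := TL y; exact: KP.
pose L' : {linear 'rV[R]_D -> V} :=
  HB.pack f (GRing.isLinear.Build R 'rV[R]_D V *:%R f fl).
have K0 : K 0 = 0.
  by have := linear0 L'; rewrite /L' /= /f linear0.
have [M MP] : exists M, forall v, `|L' v| <= M * `|L v|.
  by apply: row_linear_factor_bound => v Lv; rewrite /L' /= /f Lv.
by exists M => Y WY; have := MP (to_coord Y); rewrite /L' /= /f LT.
Qed.

End real_subspace.

(** * The equation along group orbits *)

(** The open unit interval is not negligible. *)
Lemma ae_pos_witness (R : realType) (P : R -> Prop) :
  {ae lebesgue_measure, forall t : R, 0 < t -> P t} -> exists2 t, 0 < t & P t.
Proof.
move=> [N [mN N0 sN]]; apply: contrapT => noP.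
have sub : `]0, 1[%classic `<=` N.
  move=> t; rewrite /= in_itv /= => /andP[t0 _]; apply: sN => /= Pt.
  by apply: noP; exists t; [|exact: Pt].
have : (lebesgue_measure (`]0%R, 1%R[%classic : set R) <= lebesgue_measure N)%E.
  by apply: le_measure => //; rewrite inE; [exact: measurable_itv|exact: mN].
rewrite lebesgue_measure_itv /= lte_fin ltr01 N0 oppr0 adde0.
by rewrite lee_fin ler10.
Qed.

Section equivariant_equation.
Variables (R : realType) (V : normedModType R) (A : partial_op V) (F : V -> V).
Variables (n : nat) (G : set 'M[R[i]]_n) (Pi : 'M[R[i]]_n -> {linear V -> V}).
Hypotheses (lieG : matrix_lie_group G) (repPi : bounded_representation G Pi).
Hypothesis symA : forall g phi, G g -> dom A phi ->
  dom A (Pi g phi) /\ A phi = Pi g (A (Pi (invmx g) phi)).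
Hypothesis symF : forall g phi, G g -> dom A phi ->
  F phi = Pi g (F (Pi (invmx g) phi)).
Variable u : V.
Hypothesis Au : dom A u.
Local Notation N := (@sumnorm R _ _).
Local Notation orbit := (orbit_curve Pi).

Lemma equivariant_A g : G g -> dom A (Pi g u) /\ A (Pi g u) = Pi g (A u).
Proof.
move=> Gg; have [Agu _] := symA Gg Au; split => //.
by have [_ ->] := symA Gg Agu; rewrite (repK lieG repPi).
Qed.

Lemma equivariant_F g : G g -> F (Pi g u) = Pi g (F u).
Proof.
move=> Gg; have [Agu _] := symA Gg Au.
by rewrite (symF Gg Agu) (repK lieG repPi).
Qed.

(** At a single time [t] at which the equation holds, transport both sides
    back to time 0 with the inverse of [Pi (exp (tX))]. *)
Lemma solution_generator X : lie_algebra G X -> dom (pi_op Pi X) u ->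
  strong_solution A F (orbit X u) -> pi_op Pi X u = A u + F u.
Proof.
move=> gX Xu [_ /ae_pos_witness[t t0 [_ uD]]].
pose g := expmx (t%:C%C *: X).
have Gg : G g by exact: gX.
have gV := repK lieG repPi _ Gg.
suff : Pi g (pi_op Pi X u) = Pi g (A u + F u).
  by move=> /(congr1 (Pi (invmx g))); rewrite !gV.
have <- : A (Pi g u) + F (Pi g u) = Pi g (A u + F u).
  by rewrite (equivariant_A Gg).2 (equivariant_F Gg) linearD.
have <- := @derive_val _ _ _ _ _ _ _ uD.
symmetry; apply: cvg_lim; first exact: norm_hausdorff.
have cPi : continuous (Pi g) by case: repPi => + _ _ _ _; exact.
have orbX : h^-1 *: (orbit X u h - u) @[h --> 0^'] --> pi_op Pi X u.
  exact: Xu.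
have := cvg_comp _ _ orbX (cPi (pi_op Pi X u)).
apply: cvg_trans; apply: near_eq_cvg; near=> h => /=.
rewrite [h *: 1]mulr1 (orbit_curveD _ _ _ repPi gX).
by rewrite [Pi g (_ *: _)]linearZ_LR linearB.
Unshelve. all: by end_near.
Qed.

Lemma differentiable_remainder : differentiable F u ->
  forall e : R, 0 < e -> exists2 d : R, 0 < d & forall h, `|h| < d ->
    `|F (u + h) - F u - 'd F u h| <= e * `|h|.
Proof.
move=> /diff_locallyP[_ /eqaddoP dF] e e0.
have /nbhs_ballP[d d0 dP] := dF e e0.
exists d => // h hd; have := dP h; rewrite -ball_normE /= sub0r normrN => /(_ hd).
by rewrite !fctE /= [h + u]addrC opprD addrA.
Qed.

End equivariant_equation.

(** * The linearization on the center space *)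

Section linearization_on_center.
Variables (R : realType) (V : normedModType R) (A : partial_op V) (F : V -> V).
Variables (n : nat) (G : set 'M[R[i]]_n) (Pi : 'M[R[i]]_n -> {linear V -> V}).
Hypotheses (lieG : matrix_lie_group G) (repPi : bounded_representation G Pi).
Hypothesis symA : forall g phi, G g -> dom A phi ->
  dom A (Pi g phi) /\ A phi = Pi g (A (Pi (invmx g) phi)).
Hypothesis symF : forall g phi, G g -> dom A phi ->
  F phi = Pi g (F (Pi (invmx g) phi)).
Variables (X : 'M[R[i]]_n) (u : V).
Hypotheses (gX : lie_algebra G X) (Au : dom A u).
Hypothesis piYu : forall Y, lie_algebra G Y -> dom (pi_op Pi Y) u.
Hypothesis equX : pi_op Pi X u = A u + F u.
Hypothesis diffF : differentiable F u.
Variable S : R -> {linear V -> V}.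
Local Notation L := (linearization A F Pi X u).
Hypotheses (semS : bounded_C0_semigroup S) (genS : generates L S).
Local Notation N := (@sumnorm R _ _).
Local Notation orbit := (orbit_curve Pi).
Local Notation T Y := (pi_op Pi Y u).

Lemma tangent_center Y : lie_algebra G Y -> tangent (orbit Y u) (T Y).
Proof. by move=> gY; apply/(pi_opP repPi); split => //; exact: piYu. Qed.

Lemma lie_algebraP (a : R) Y Z : lie_algebra G Y -> lie_algebra G Z ->
  lie_algebra G (a%:C%C *: Y + Z).
Proof. by move=> gY gZ; exact: (lie_algebraD lieG (lie_algebraZ a gY) gZ). Qed.

Lemma lie_algebraB Y Z : lie_algebra G Y -> lie_algebra G Z ->
  lie_algebra G (Y - Z).
Proof.
move=> gY gZ; have := lie_algebraP (-1) gZ gY.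
by rewrite rmorphN rmorph1 scaleN1r addrC.
Qed.

Lemma conj_difference (t : R) g : G g ->
  lie_algebra G (t%:C%C *: (X - invmx g *m X *m g)).
Proof.
move=> Gg; apply: lie_algebraZ; apply: (lie_algebraB gX).
exact: (lie_algebra_conj lieG Gg gX).
Qed.

Lemma center_linear (a : R) Y Z : lie_algebra G Y -> lie_algebra G Z ->
  T (a%:C%C *: Y + Z) = a *: T Y + T Z.
Proof.
move=> gY gZ.
have gaY : lie_algebra G (a%:C%C *: Y) by exact: lie_algebraZ.
have caY := tangent_orbitZ a (tangent_center gY).
have := tangent_orbitD lieG repPi gaY gZ caY (tangent_center gZ).
by move/(pi_opP repPi) => -[].
Qed.

Lemma center_linearB Y Z : lie_algebra G Y -> lie_algebra G Z ->
  T (Y - Z) = T Y - T Z.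
Proof.
move=> gY gZ; have -> : Y - Z = (-1)%:C%C *: Z + Y.
  by rewrite rmorphN rmorph1 scaleN1r addrC.
rewrite [RHS]addrC -(scaleN1r (T Z)); exact: center_linear.
Qed.

Lemma center_linearZ (a : R) Y : lie_algebra G Y -> T (a%:C%C *: Y) = a *: T Y.
Proof.
move=> gY; have := tangent_orbitZ a (tangent_center gY).
by move/(pi_opP repPi) => -[].
Qed.

(** The derivative of the action in the direction [X] at [Pi g u] is [Pi g (T
    (g^-1 X g))], and [A (Pi g u)] equals [Pi g (T X)] minus [F (Pi g u)]. *)
Lemma linearization_orbit g : G g -> dom L (Pi g u) /\
  L (Pi g u) = Pi g (T X - T (invmx g *m X *m g)) - F (Pi g u)
               + 'd F u (Pi g u).
Proof.
move=> Gg; have [Agu AguE] := equivariant_A lieG repPi symA Au Gg.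
have gXg := lie_algebra_conj lieG Gg gX.
have := tangent_orbit_conj lieG repPi Gg gX (tangent_center gXg).
move/(pi_opP repPi) => -[Xgu XguE].
split; first by split.
have -> : L (Pi g u) = A (Pi g u) - pi_op Pi X (Pi g u) + 'd F u (Pi g u).
  by [].
have aux (P : {linear V -> V}) a f z x a' f' z' d :
    x = a + f -> a' = P a -> z' = P z -> f' = P f ->
    a' - z' + d = P (x - z) - f' + d.
  by move=> -> -> -> ->; rewrite -!linearB [a + f - z]addrAC addrK.
exact: aux equX AguE XguE (equivariant_F lieG repPi symA symF Au Gg).
Qed.

Lemma linearization_base : dom L u /\ L u = 'd F u u - F u.
Proof.
split; first by split => //; exact: piYu.
have -> : L u = A u - T X + 'd F u u by [].
by rewrite equX opprD addrA subrr sub0r addrC.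
Qed.

Lemma linearization_quotient (t : R) g : G g ->
  dom L (t *: (Pi g u - u)) /\
  L (t *: (Pi g u - u)) = Pi g (T (t%:C%C *: (X - invmx g *m X *m g)))
    - t *: (F (Pi g u) - F u - 'd F u (Pi g u - u)).
Proof.
move=> Gg; have [dg Lg] := linearization_orbit Gg.
have [du Lu] := linearization_base.
have gXg := lie_algebra_conj lieG Gg gX.
have lin := generator_linear genS.
have [d1 L1] := lin (-1) _ _ du dg.
have [d0 L0] := lin (-1) _ _ d1 d1.
have [d2 L2] := lin t _ _ d1 d0.
(* Linearity is available for expressions [a *: x + y]; the last summand is 0.
   *)
have E : t *: (Pi g u - u) = t *: (-1 *: u + Pi g u) +
    (-1 *: (-1 *: u + Pi g u) + (-1 *: u + Pi g u)).
  by rewrite !scaleN1r addNr addr0 addrC.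
rewrite E; split; first exact: d2.
have TD := etrans (center_linearZ t (lie_algebraB gX gXg))
  (congr1 (fun w => t *: w) (center_linearB gX gXg)).
have aux (P : {linear V -> V}) (l2 v z lu lg f f' du' dg' d w y : V) :
    l2 = t *: v + z -> z = -1 *: v + v -> v = -1 *: lu + lg ->
    lu = du' - f -> lg = P w - f' + dg' -> y = t *: w -> d = dg' - du' ->
    l2 = P y - t *: (f' - f - d).
  move=> -> -> -> -> -> -> ->; rewrite !scaleN1r addNr addr0.
  rewrite [P (t *: w)]linearZ_LR -scalerBr; congr (t *: _).
  rewrite opprB [LHS]addrC -(addrA (P w)) -addrA; congr (_ + _).
  by rewrite !opprB (addrC _ dg') addrACA [RHS]addrACA; congr (_ + _); exact: addrC.
exact: aux L2 L0 L1 Lu Lg TD (linearB _ _ _).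
Qed.

(** The bracket is the limit of [(X - g^-1 X g) / t] with [g = exp (tY)]. *)
Lemma lie_bracket_closed Y : lie_algebra G Y -> lie_algebra G (lie_bracket Y X).
Proof.
move=> gY; apply: (subspace_closed (lie_algebra0 lieG) lie_algebraP) => e e0.
have [K K0 KP] := adjoint_derivative X Y.
have K1 : 0 < K + 1 by rewrite ltr_wpDl.
pose t := Num.min 1 (e / (K + 1)).
have t0 : 0 < t by rewrite lt_min ltr01 divr_gt0.
have Gg : G (expmx (t%:C%C *: Y)) by exact: gY.
exists (t^-1%:C%C *: (X - invmx (expmx (t%:C%C *: Y)) *m X *m expmx (t%:C%C *: Y))).
  exact: conj_difference.
rewrite (le_trans (KP t _ _)) ?gt_eqF// ?gtr0_norm// ?ge_min ?lexx//.
rewrite (@le_trans _ _ (K * (e / (K + 1))))//.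
  by rewrite ler_wpM2l// ge_min lexx orbT.
by rewrite mulrCA ler_piMr ?(ltW e0)// ler_pdivrMr// mul1r lerDl.
Qed.

(** The difference quotients of the orbit of [u] approximate [T Y] in the
    graph norm of the generator. *)
Lemma linearization_center Y : lie_algebra G Y ->
  dom L (T Y) /\ L (T Y) = T (lie_bracket Y X).
Proof.
move=> gY; apply: (generator_closed semS genS) => e e0.
have [M M0 PM] := rep_bound repPi.
have [C C0 CP] := subspace_linear_bounded (lie_algebra0 lieG) lie_algebraP
  center_linear.
have [K K0 KP] := adjoint_derivative X Y.
have gYX := lie_bracket_closed gY.
pose c := T (lie_bracket Y X).
have e3 : 0 < e / 3 by rewrite divr_gt0.
pose e1 := Num.min e 1; have e10 : 0 < e1 by rewrite lt_min e0 ltr01.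
have [d1 d10 d1P] := tangent_center gY e10.
have TY1 : 0 < `|T Y| + 1 by rewrite ltr_wpDl.
have [d2 d20 d2P] := differentiable_remainder diffF (divr_gt0 e3 TY1).
have [d3 d30 d3P] := rep_cont1 lieG repPi c e3.
have NY1 : 0 < N Y + 1 by rewrite ltr_wpDl// sumnorm_ge0.
have MCK1 : 0 < M * C * K + 1 by rewrite ltr_wpDl// !mulr_ge0.
near (0 : R)^' => t.
have t0 : t != 0 by near: t; exact: nbhs_dnbhs_neq.
have t1 : `|t| < 1 by near: t; exact: dnbhs0_lt.
have td1 : `|t| < d1 by near: t; exact: dnbhs0_lt.
have td2 : `|t| < d2 / (`|T Y| + 1).
  by near: t; apply: dnbhs0_lt; exact: divr_gt0.
have td3 : `|t| < d3 / (N Y + 1) by near: t; apply: dnbhs0_lt; exact: divr_gt0.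
have te : `|t| < e / 3 / (M * C * K + 1).
  by near: t; apply: dnbhs0_lt; exact: divr_gt0.
have nt : 0 < `|t| by rewrite normr_gt0.
set g := expmx (t%:C%C *: Y).
have Gg : G g by exact: gY.
have [dL LE] := linearization_quotient t^-1 Gg.
have ht : `|Pi g u - u - t *: T Y| <= e1 * `|t|.
  by have := d1P t td1; rewrite (orbit_curve0 repPi).
have hu : `|Pi g u - u| <= (`|T Y| + 1) * `|t|.
  rewrite -(subrK (t *: T Y) (Pi g u - u)) (le_trans (ler_normD _ _))//.
  rewrite normrZ mulrDl addrC mulrC lerD// (le_trans ht)//.
  by rewrite ler_wpM2r// ge_min lexx orbT.
exists (t^-1 *: (Pi g u - u)) => //; split.
  have -> : t^-1 *: (Pi g u - u) - T Y = t^-1 *: (Pi g u - u - t *: T Y).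
    by rewrite [RHS]scalerBr scalerA mulVf// scale1r.
  rewrite normrZ normfV ler_pdivrMl// (le_trans ht)// mulrC ler_wpM2l//.
  by rewrite ge_min lexx.
pose D : 'M[R[i]]_n := t^-1%:C%C *: (X - invmx g *m X *m g).
have gD : lie_algebra G D by exact: conj_difference.
pose rem := F (Pi g u) - F u - 'd F u (Pi g u - u).
have split_err (P : {linear V -> V}) x y z l : l = P x - z ->
    l - y = P (x - y) + (P y - y) - z.
  by move=> ->; rewrite linearB subrKA addrAC.
rewrite (split_err _ _ _ _ _ LE).
rewrite (le_trans (ler_normB _ _))// [leRHS](_ : _ = e / 3 + e / 3 + e / 3); last by field.
rewrite lerD//.
  rewrite (le_trans (ler_normD _ _))// lerD//.
    rewrite (le_trans (PM _ _ Gg))// -(center_linearB gD gYX).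
    have gDc := lie_algebraB gD gYX.
    rewrite (le_trans (ler_wpM2l M0 (CP _ gDc)))//.
    rewrite (le_trans (ler_wpM2l M0 (ler_wpM2l C0 (KP t t0 (ltW t1)))))//.
    rewrite !mulrA (@le_trans _ _ ((M * C * K + 1) * `|t|))//.
      by rewrite ler_wpM2r// lerDl.
    by rewrite mulrC -ler_pdivlMr// ltW.
  apply: (d3P (`|t| * N Y)) => //.
    rewrite (@le_trans _ _ (`|t| * (N Y + 1)))//.
      by rewrite ler_wpM2l// lerDl.
    by rewrite -ler_pdivlMr// ltW.
  by rewrite /near_one (le_trans (expmx_near1 _))// sumnormZ.
rewrite normrZ normfV ler_pdivrMl// /rem.
have hd2 : `|Pi g u - u| < d2.
  by rewrite (le_lt_trans hu)// mulrC -ltr_pdivlMr.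
have := d2P _ hd2; rewrite subrKC => /le_trans; apply.
rewrite (le_trans (ler_wpM2l _ hu))//; first by rewrite divr_ge0// ltW.
by rewrite mulrA divfK ?gt_eqF// mulrC.
Unshelve. all: by end_near.
Qed.

Lemma linearization_restricts :
  restricts_to_bounded L (center_space G Pi u).
Proof.
have lin := generator_linear genS.
split.
- by move=> _ [Y gY <-]; exact: (linearization_center gY).1.
- move=> _ [Y gY <-]; exists (lie_bracket Y X).
    exact: lie_bracket_closed.
  exact: esym (linearization_center gY).2.
- split.
    exists 0; first exact: lie_algebra0.
    have := center_linearZ 0 (lie_algebra0 lieG).
    by rewrite !scale0r.
  move=> a _ _ [Y gY <-] [Z gZ <-]; split.
    exists (a%:C%C *: Y + Z); first exact: lie_algebraP.
    exact: center_linear.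
  exact: (lin a _ _ (linearization_center gY).1 (linearization_center gZ).1).2.
- have [M MP] := @subspace_image_bounded _ _ _ (lie_algebra0 lieG) lie_algebraP
    _ _ center_linear L (fun a Y Z gY gZ =>
      (lin a _ _ (linearization_center gY).1 (linearization_center gZ).1).2).
  by exists M => _ [Y gY <-]; exact: MP.
Qed.

End linearization_on_center.

Theorem proposition3p8
  (R : realType) (V : completeNormedModType R)
  (A : partial_op V) (F : V -> V)
  (linA : linear_op A) (closedA : closed_op A)
  (n : nat) (G : set 'M[R[i]]_n) (nrm : 'M[R[i]]_n -> R)
  (lieG : matrix_lie_group G) (nrmP : norm_on (lie_algebra G) nrm)
  (Pi : 'M[R[i]]_n -> {linear V -> V}) (repPi : bounded_representation G Pi)
  (symA : forall g phi, G g -> dom A phi ->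
     dom A (Pi g phi) /\ A phi = Pi g (A (Pi (invmx g) phi)))
  (symF : forall g phi, G g -> dom A phi ->
     F phi = Pi g (F (Pi (invmx g) phi)))
  (X : 'M[R[i]]_n) (gX : lie_algebra G X)
  (u : V) (Au : dom A u) (piXu : dom (pi_op Pi X) u)
  (solu : strong_solution A F (fun t : R => Pi (expmx ((t%:C)%C *: X)) u))
  (piYu : forall Y, lie_algebra G Y -> dom (pi_op Pi Y) u)
  (quadu : exists C : R, forall Y, lie_algebra G Y ->
     `|Pi (expmx Y) u - u - pi_op Pi Y u| <= C * nrm Y ^+ 2)
  (diffF : differentiable F u)
  (S : R -> {linear V -> V}) (semS : bounded_C0_semigroup S)
  (genS : generates (linearization A F Pi X u) S) :
  (forall Y, lie_algebra G Y ->
     [/\ dom (linearization A F Pi X u) (pi_op Pi Y u),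
         dom (pi_op Pi (lie_bracket Y X)) u &
         linearization A F Pi X u (pi_op Pi Y u) =
           pi_op Pi (lie_bracket Y X) u]) /\
  restricts_to_bounded (linearization A F Pi X u) (center_space G Pi u).
Proof.
have equX := solution_generator lieG repPi symA symF Au gX piXu solu.
split; last exact: (linearization_restricts lieG repPi symA symF gX Au piYu
  equX diffF semS genS).
move=> Y gY.
have [dY LY] := linearization_center lieG repPi symA symF gX Au piYu
  equX diffF semS genS gY.
by split; [exact: dY|exact: piYu (lie_bracket_closed lieG gX gY)|exact: LY].
Qed.
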